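(* Let $G^*$ be an $n$-vertex connected class 1 $\Delta$-regular graph with $\Delta \geq \frac{2(n - 1)}{3}$. If $G$ is obtained from $G^*$ by a vertex-splitting, then $G$ is $\Delta$-critical.
   Context: All graphs are finite and simple. $\chi'(G)$ is the chromatic index and $\Delta(G)$ the maximum degree of $G$. A graph $G$ is class 1 if $\chi'(G)=\Delta(G)$, and class 2 if $\chi'(G)=\Delta(G)+1$. A graph $G$ is $\Delta$-critical if $\chi'(G)=\Delta(G)+1$ (with $\Delta(G)=\Delta$) and $\chi'(H)<\chi'(G)$ for every proper subgraph $H$ of $G$. A vertex-splitting in $G^*$ at a vertex $v$ gives a new graph $G$ obtained by replacing $v$ with two new adjacent vertices $v_1$ and $v_2$ and partitioning the neighborhood $N_{G^*}(v)$ into two nonempty subsets that, respectively, serve as the set of neighbors of $v_1$ and of $v_2$ from $V(G^* )$ in $G$. In this case $G$ is said to be obtained from $G^*$ by a vertex-splitting. *)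

(* Defs.v *)
From mathcomp Require Import all_boot.

Set Implicit Arguments.
Unset Strict Implicit.
Unset Printing Implicit Defensive.

(* A finite simple graph whose vertices are drawn from the finite type T.
   T may be larger than the vertex set: subgraphs, and graphs with vertices
   outside vset G, are then again graphs over the same T. *)
Record sgraph (T : finType) := SGraph {
  vset : {set T};
  eset : {set {set T}};
  esetP : forall e : {set T}, e \in eset -> (e \subset vset) && (#|e| == 2)
}.

Section Graphs.
Variable T : finType.
Implicit Types (G H : sgraph T) (x y v : T) (D k : nat).

Definition adj G : rel T := fun x y => [set x; y] \in eset G.

Definition nbrs G v : {set T} := [set x | adj G v x].

Definition deg G v : nat := #|nbrs G v|.

Definition max_deg G : nat := \max_(x in vset G) deg G x.

Definition regular D G : Prop := forall x, x \in vset G -> deg G x = D.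

Definition connected G : Prop :=
  vset G != set0 /\
  forall x y, x \in vset G -> y \in vset G -> connect (adj G) x y.

(* Colours are assigned to the actual edges only, so that an edgeless graph
   is 0-edge-colourable. *)
Definition edge G : finType := {e : {set T} | e \in eset G}.

Definition proper_edge_coloring G k (c : {ffun edge G -> 'I_k}) : bool :=
  [forall e : edge G, forall f : edge G,
     (e != f) && (val e :&: val f != set0) ==> (c e != c f)].

Definition edge_colorable G k : bool :=
  [exists c : {ffun edge G -> 'I_k}, proper_edge_coloring c].

Lemma edge_colorable_ex G : exists k, edge_colorable G k.
Proof.
exists #|edge G|; apply/existsP; exists [ffun e => enum_rank e].
apply/forallP => e; apply/forallP => f; apply/implyP => /andP[ef _].
by rewrite !ffunE (inj_eq enum_rank_inj).
Qed.

Definition chromatic_index G : nat := ex_minn (edge_colorable_ex G).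

Definition class1 G : Prop := chromatic_index G = max_deg G.

Definition subgraph H G : bool :=
  (vset H \subset vset G) && (eset H \subset eset G).

Definition proper_subgraph H G : bool :=
  subgraph H G && ((vset H != vset G) || (eset H != eset G)).

Definition critical D G : Prop :=
  [/\ max_deg G = D,
      chromatic_index G = D.+1 &
      forall H, proper_subgraph H G -> chromatic_index H < chromatic_index G].

Definition vertex_splitting_at G' v G : Prop :=
  exists v1 v2 : T, exists N1 N2 : {set T},
    [/\ [/\ v1 \notin vset G', v2 \notin vset G' & v1 != v2],
        [/\ N1 :|: N2 = nbrs G' v, [disjoint N1 & N2], N1 != set0 & N2 != set0],
        vset G = [set v1; v2] :|: (vset G' :\ v) &
        eset G = [set e in eset G' | v \notin e] :|: [set [set v1; v2]]
                 :|: [set [set v1; x] | x in N1]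
                 :|: [set [set v2; x] | x in N2]].

Definition vertex_splitting G' G : Prop :=
  exists2 v, v \in vset G' & vertex_splitting_at G' v G.

End Graphs.

(* Main.v *)
Require Import Defs.
From mathcomp Require Import all_boot zify.

Set Implicit Arguments.
Unset Strict Implicit.
Unset Printing Implicit Defensive.

(** Write [D] for the degree.  The order of [G*] is even, so [G] has too many
    edges for [D] colours, and it remains to colour [G - e] with [D] colours for
    every edge [e].  The colourings of [G - v1 v2] come from those of [G*].  If [e]
    is an edge at [v1] or [v2], its colour can be moved to [v1 v2].  For
    any other edge [e = x y] assume that [G - e] has no [D]-colouring.  Kempe
    changes along a Kierstead path [v1 v2 u x] show that [v1], say, has only one
    neighbour [a] besides [v2] and that [x] and [y] are adjacent to neither [a] nor
    [v2].  By the degree condition [a], [v2] and [x] have a common neighbour [u],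
    and either some such [u] is adjacent to [y] (a kite), or [u] and [y] have many
    common neighbours [w] (a broom).  In both configurations a tree of Kempe
    changes leads to a colouring of [G - v1 v2 - v1 a - x y] in which [a] and [v2]
    miss different colours, and this colouring extends to [G - x y]. *)

(** * Involutions and alternating chains *)

(** The obstacle is [v1] with a single neighbour. If [G - x y] has no colouring, every colour of
    [G - v1 v2 - x y] is missing at exactly one of [v1] and [v2], because their degrees there add up
    to [D]; so [v2] misses as many colours as [v1] has neighbours. A Kierstead path needs two of
    them, and with only one the kite and the broom have to replace it. All vertices other than [v1],
    [v2], [x], [y] see every colour, so a two-coloured chain can end only at a few known vertices.
    Where it ends is thus a finite question, and each Kempe argument becomes a finite tree with one
    branch per answer. These trees are data, checked by computation; one soundness theorem turns a
    successful check into a statement on colourings. The bound [2(n-1)/3] makes three neighbourhoods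
    of size [D-1] among [n-4] vertices meet. A fourth one meets them when [4D + 8 > 3n]; otherwise
    the two inequalities force [n >= 16], which is just what the broom needs to avoid four bad
    choices of [w]. *)

Lemma odd_fixed_involution (T : finType) (f : T -> T) (A : {set T}) :
  involutive f -> {in A, forall x, f x \in A} ->
  odd #|[set x in A | f x == x]| = odd #|A|.
Proof.
move=> fK; have [n] := ubnP #|A|; elim: n A => // n IHn A leA fA.
have [/exists_inP[x Ax fx]|/exists_inPn nofix] := boolP [exists x in A, f x != x].
  (* A two-cycle contributes two points, neither of them fixed, so removing it changes no parity. *)
  pose B := A :\ x :\ f x.
  have Bfx : f x \in A :\ x by rewrite !inE fx fA.
  have cA : #|A| = #|B|.+2.
    by rewrite (cardsD1 x) Ax (cardsD1 (f x) (A :\ x)) Bfx.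
  have fB : {in B, forall y, f y \in B}.
    move=> y; rewrite !inE => /and3P[yfx yx Ay]; rewrite fA // andbT.
    by rewrite (inj_eq (inv_inj fK)) yx -{1}(fK x) (inj_eq (inv_inj fK)) yfx.
  have -> : [set y in A | f y == y] = [set y in B | f y == y].
    apply/setP => y; rewrite !inE; have [->|yx] := eqVneq y x.
      by rewrite (negPf fx) !andbF.
    have [->|//] := eqVneq y (f x).
    by rewrite fK eq_sym (negPf fx) andbF.
  rewrite IHn ?cA //=; last by move: leA; rewrite cA; lia.
  by rewrite negbK.
congr (odd _); apply: eq_card => x; rewrite !inE.
by case Ax: (x \in A) => //=; have := nofix x Ax; rewrite negbK.
Qed.

Section Chains.
Variables (T : finType) (f g : T -> T).
Hypotheses (fK : involutive f) (gK : involutive g).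
Implicit Types x y z : T.

Definition chain : rel T := [rel x y | (x != y) && ((f x == y) || (g x == y))].

Definition chain_end x := (f x == x) != (g x == x).

Lemma chain_sym : symmetric chain.
Proof.
move=> x y; rewrite /chain /= eq_sym; congr (_ && _).
by rewrite (can2_eq fK fK) (can2_eq gK gK) ![x == _]eq_sym.
Qed.

Lemma connect_chain_sym : connect_sym chain.
Proof. exact: sym_connect_sym chain_sym. Qed.

Lemma connect_chain_l x : connect chain x (f x).
Proof.
have [->|fx] := eqVneq (f x) x; first exact: connect0.
by apply: connect1; rewrite /chain /= [x == _]eq_sym fx eqxx.
Qed.

Lemma connect_chain_r x : connect chain x (g x).
Proof.
have [->|gx] := eqVneq (g x) x; first exact: connect0.
by apply: connect1; rewrite /chain /= [x == _]eq_sym gx eqxx orbT.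
Qed.

(** Parity: the component of [x] is stable under both involutions, so their numbers of fixed points
    in it are both congruent to its size. Were [x] the only end, the two fixed point sets would
    differ in [x] alone. *)
Lemma chain_end_partner x : chain_end x ->
  exists y, [/\ y != x, chain_end y & connect chain x y].
Proof.
move=> xe; pose A := [set y | connect chain x y].
have [/existsP[y /and3P[]]|/existsPn noend] :=
  boolP [exists y, [&& y != x, chain_end y & connect chain x y]]; first by exists y.
have fA : {in A, forall y, f y \in A}.
  by move=> y; rewrite !inE => /connect_trans; apply; apply: connect_chain_l.
have gA : {in A, forall y, g y \in A}.
  by move=> y; rewrite !inE => /connect_trans; apply; apply: connect_chain_r.
have := odd_fixed_involution fK fA; rewrite -(odd_fixed_involution gK gA).
have Ax : x \in A by rewrite inE connect0.
rewrite (cardsD1 x) [in RHS](cardsD1 x) !inE connect0 /= !oddD.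
have -> : [set y in A | f y == y] :\ x = [set y in A | g y == y] :\ x.
  apply/setP => y; rewrite !inE; have := noend y.
  rewrite /chain_end; case: (y == x) => //=; case: (connect _ _ _) => //=.
  by rewrite andbT negbK => /eqP->.
by move/addIb; move: xe; rewrite /chain_end; do 2 case: (_ == x).
Qed.

Lemma chain_two x a b y : chain x a -> chain x b -> a != b -> chain x y -> (y == a) || (y == b).
Proof.
rewrite /chain /= => /andP[_ /orP[]/eqP<-] /andP[_ /orP[]/eqP<-]; rewrite ?eqxx // => _.
  by case/andP=> _ /orP[]/eqP<-; rewrite eqxx ?orbT.
by case/andP=> _ /orP[]/eqP<-; rewrite eqxx ?orbT.
Qed.

Lemma chain_end_one x a b : chain_end x -> chain x a -> chain x b -> a = b.
Proof.
rewrite /chain_end /chain /= => xe /andP[xa ea] /andP[xb eb]; move: xe ea eb.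
case: (eqVneq (f x) x) => [->|_].
  by rewrite (negPf xa) (negPf xb) => _ /eqP<- /eqP<-.
case: (eqVneq (g x) x) => // -> _; rewrite (negPf xa) (negPf xb) !orbF.
by move=> /eqP<- /eqP<-.
Qed.

(* A simple path between two ends already contains all neighbours of its
   vertices, hence is a whole component, and its inner vertices are no ends. *)
Lemma chain_end_unique x y z : chain_end x -> chain_end y -> chain_end z ->
  y != x -> z != x -> connect chain x y -> connect chain x z -> z = y.
Proof.
move=> xe ye ze yx zx /connectP[p0 p0P yp0] xz; move: ye yx; rewrite {y}yp0.
case/shortenP: p0P => p pP pU _ ye yx {p0}.
pose s := x :: p; pose a i := nth x s i.
have p0 : 0 < size p by rewrite lt0n; apply: contraNneq yx => /size0nil->.
have aS i : i < size p -> chain (a i) (a i.+1) by move=> ip; apply: (pathP x pP).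
have aN i j : i <= size p -> j <= size p -> i != j -> a i != a j.
  by move=> ip jp ij; rewrite nth_uniq.
have a_in i : i <= size p -> a i \in s by move=> ip; rewrite mem_nth.
have pred_le i : i <= size p -> i.-1 <= size p by apply: leq_trans (leq_pred i).
have nei i : i < size p -> a i.-1 != a i.+1.
  by move=> ip; apply: aN => //; [exact/pred_le/ltnW | rewrite neq_ltn ltnS leq_pred].
have alast : a (size p) = last x p by rewrite /a /s /= -last_nth.
have inner i : 0 < i < size p -> chain (a i) (a i.-1) /\ chain (a i) (a i.+1).
  case: i => // i /= ip; split; last exact: aS.
  by rewrite chain_sym aS // ltnW.
have scl : closed chain [in s].
  apply: intro_closed => [|t w tw]; first exact: connect_chain_sym.
  case/(nthP x)=> i; rewrite -/(a i) /= ltnS => ip ai.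
  have [i0|i0] := posnP i.
    have -> : w = a 1 by apply: (chain_end_one (x := t)) => //; rewrite -ai i0 //; apply: aS.
    exact: a_in.
  have [iL|iL] := eqVneq i (size p).
    have -> : w = a i.-1.
      apply: (chain_end_one (x := t)) => //; rewrite -ai ?iL ?alast //.
      by rewrite -alast chain_sym -{2}(prednK p0) aS // prednK.
    exact/a_in/pred_le.
  have iS : i < size p by rewrite ltn_neqAle iL.
  have [i1 i2] : chain (a i) (a i.-1) /\ chain (a i) (a i.+1) by apply: inner; rewrite i0.
  rewrite ai in i1 i2; case/orP: (chain_two i1 i2 (nei _ iS) tw) => /eqP->; last exact: a_in.
  exact/a_in/pred_le.
have : z \in s by rewrite -(closed_connect scl xz) mem_head.
case/(nthP x)=> i; rewrite -/(a i) /= ltnS => ip ai.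
have i0 : 0 < i by case: (i) ai => // /esym zx0; rewrite zx0 eqxx in zx.
have [iL|iL] := eqVneq i (size p); first by rewrite -ai iL alast.
have iS : i < size p by rewrite ltn_neqAle iL.
have [i1 i2] : chain (a i) (a i.-1) /\ chain (a i) (a i.+1) by apply: inner; rewrite i0.
rewrite ai in i1 i2; have e := chain_end_one ze i1 i2.
by have := nei i iS; rewrite e eqxx.
Qed.

End Chains.

(** * Partial colourings and the Kempe-change game *)

(* A partial proper edge colouring is a family of involutions: [m i x] is the
   neighbour of [x] along colour [i], and [m i x = x] when [x] misses [i]. *)
Definition proper_family (T I : Type) (m : I -> T -> T) : Prop :=
  (forall i, involutive (m i)) /\
  (forall i j x, m i x = m j x -> m i x <> x -> i = j).

Definition swap2 (A : eqType) (a b c : A) := if c == a then b else if c == b then a else c.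

Lemma swap2K (A : eqType) (a b : A) : involutive (swap2 a b).
Proof.
move=> c; rewrite /swap2; case: (eqVneq c a) => [->|ca].
  by rewrite eqxx; case: eqVneq.
case: (eqVneq c b) => [->|cb]; rewrite ?eqxx //.
by rewrite (negPf ca) (negPf cb).
Qed.

Lemma swap2_inj (A : eqType) (a b : A) : injective (swap2 a b).
Proof. exact: inv_inj (swap2K a b). Qed.

Lemma swap2l (A : eqType) (a b : A) : swap2 a b a = b.
Proof. by rewrite /swap2 eqxx. Qed.

Lemma swap2r (A : eqType) (a b : A) : swap2 a b b = a.
Proof. by rewrite /swap2 eqxx; case: eqVneq. Qed.

Lemma swap2_id (A : eqType) (a b c : A) : c != a -> c != b -> swap2 a b c = c.
Proof. by rewrite /swap2 => /negPf-> /negPf->. Qed.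

Lemma swap2_in (A : eqType) (a b c : A) :
  (swap2 a b c == a) || (swap2 a b c == b) = (c == a) || (c == b).
Proof.
by rewrite !(can2_eq (swap2K a b) (swap2K a b)) swap2l swap2r orbC.
Qed.

(** * Kempe changes, and changing the colour of one edge *)

Section KempeSwap.
Variables (T : finType) (I : eqType) (m : I -> T -> T) (a b : I) (X : pred T).
Hypotheses (mP : proper_family m)
  (Xa : forall z, X (m a z) = X z) (Xb : forall z, X (m b z) = X z).

(** [X] may be any union of components in the colours [a] and [b], so several chains can be
    exchanged at once. *)
Definition kempe (c : I) (z : T) := if X z then m (swap2 a b c) z else m c z.

Lemma kempeE c z : kempe c z = m (if X z then swap2 a b c else c) z.
Proof. by rewrite /kempe; case: (X z). Qed.

Lemma kempe_other c z : c != a -> c != b -> kempe c z = m c z.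
Proof. by move=> ca cb; rewrite /kempe swap2_id // if_same. Qed.

Lemma kempe_swap c z : (c == a) || (c == b) -> X (m c z) = X z.
Proof. by case/orP=> /eqP->. Qed.

Lemma kempe_proper : proper_family kempe.
Proof.
have [mK mI] := mP; split=> [c z|c d z]; last first.
  rewrite !kempeE => e n; have := mI _ _ _ e n.
  by case: (X z) => // /swap2_inj.
have [cab|] := boolP ((c == a) || (c == b)); last first.
  by case/norP=> ca cb; rewrite !kempe_other // mK.
rewrite [X in kempe c X]kempeE kempeE.
have -> : X (m (if X z then swap2 a b c else c) z) = X z.
  by apply: kempe_swap; case: (X z); rewrite ?swap2_in.
exact: mK.
Qed.

End KempeSwap.

Section SetEdge.
Variables (T I : eqType) (m : I -> T -> T) (i : I) (u v : T).
Hypothesis mP : proper_family m.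

Definition uncolour (c : I) (z : T) :=
  if (c == i) && ((z == u) || (z == v)) then z else m c z.

Lemma uncolour_proper : m i u = v -> proper_family uncolour.
Proof.
move=> muv; have [mK mI] := mP.
have mvu : m i v = u by rewrite -muv mK.
split=> [c z|c d z]; rewrite /uncolour.
  have [ci|ci] := eqVneq c i; rewrite ?mK //= ci.
  case zuv: ((z == u) || (z == v)); rewrite ?zuv //.
  have -> : (m i z == u) || (m i z == v) = (z == u) || (z == v).
    by rewrite !(can2_eq (mK i) (mK i)) muv mvu orbC.
  by rewrite zuv mK.
case: ifP => [_ _ //|_]; case: ifP => [_ -> //|_]; exact: mI.
Qed.

Definition colour (c : I) (z : T) :=
  if c == i then (if z == u then v else if z == v then u else m c z) else m c z.

(** The last hypothesis says that [u v] carries no colour yet; otherwise it would receive two. *)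
Lemma colour_proper : u != v -> m i u = u -> m i v = v -> (forall c, m c u != v) ->
  proper_family colour.
Proof.
move=> uv mu mv muv; have [mK mI] := mP.
have mvu c : m c v != u by rewrite (can2_eq (mK c) (mK c)) eq_sym.
split=> [c z|c d z]; rewrite /colour.
  have [ci|ci] := eqVneq c i; rewrite ?mK //.
  case: (eqVneq z u) => [->|zu]; first by rewrite eqxx eq_sym (negPf uv).
  case: (eqVneq z v) => [->|zv]; first by rewrite eqxx.
  rewrite ci -{1}mu (inj_eq (inv_inj (mK i))) (negPf zu).
  by rewrite -{1}mv (inj_eq (inv_inj (mK i))) (negPf zv) mK.
case: (eqVneq c i) => [->|ci]; case: (eqVneq d i) => [->|di] //; last exact: mI.
  case: (eqVneq z u) => [->|zu]; first by move=> e; case/eqP: (muv d).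
  case: (eqVneq z v) => [->|zv]; first by move=> e; case/eqP: (mvu d).
  exact: mI.
case: (eqVneq z u) => [->|zu]; first by move=> e; case/eqP: (muv c).
case: (eqVneq z v) => [->|zv]; first by move=> e; case/eqP: (mvu c).
exact: mI.
Qed.

End SetEdge.

(* A position of the Kempe-change game records what is known about
   a partial colouring on finitely many named vertices and colours: the colours
   of the named edges ([None]: uncoloured), the colours missing at the named
   vertices, and pairs of chain ends [(i, j, p, q)] such that the (i,j)-chain
   leaving [p] along unnamed edges ends in [q]. *)
Record position := Position {
  pcol : nat -> option nat;
  pmis : nat -> pred nat;
  parc : seq (nat * nat * nat * nat)
}.

(* [Unc e] and [Col e i] uncolour the edge [e] and colour it with [i];
   [Fol i j p] asks where the (i,j)-chain leaving [p] along unnamed edges ends,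
   with one continuation for each possible answer; [Swp i j X] exchanges [i] and
   [j] on the chains that contain the named vertices in [X]. *)
Inductive strategy :=
| Goal
| Unc of nat & strategy
| Col of nat & nat & strategy
| Fol of nat & nat & nat & seq strategy
| Swp of nat & nat & seq nat & strategy.

(** [Fol] nests strategies in a sequence, for which the generated principle has no hypothesis; the
    [foldr] conjunction supplies one per continuation. *)
Fixpoint strategy_ind' (P : strategy -> Prop) (hG : P Goal)
  (hU : forall e s, P s -> P (Unc e s)) (hC : forall e i s, P s -> P (Col e i s))
  (hF : forall i j p ss, foldr (fun s Q => P s /\ Q) True ss -> P (Fol i j p ss))
  (hS : forall i j X s, P s -> P (Swp i j X s)) s : P s :=
  let F := strategy_ind' hG hU hC hF hS in
  match s with
  | Goal => hG
  | Unc e s => hU e s (F s)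
  | Col e i s => hC e i s (F s)
  | Fol i j p ss => hF i j p ss ((fix G (ss : seq strategy) : foldr (fun s Q => P s /\ Q) True ss :=
      match ss with [::] => I | s :: ss => conj (F s) (G ss) end) ss)
  | Swp i j X s => hS i j X s (F s)
  end.

Section Game.
Variables (n k : nat) (el : seq (nat * nat)) (goal : pred position).
Implicit Types (S : position) (p q i j e : nat).

Definition src e := (nth (0, 0) el e).1.
Definition tgt e := (nth (0, 0) el e).2.

(** An unnamed edge of colour [i] leaves [p]. Chains are followed along such edges only. *)
Definition halfedge S p i :=
  ~~ pmis S p i &&
  ~~ has (fun e => (pcol S e == Some i) && ((src e == p) || (tgt e == p))) (iota 0 (size el)).

Definition isend S i j p := halfedge S p i != halfedge S p j.

Definition linked S i j p q := ((i, j, p, q) \in parc S) || ((i, j, q, p) \in parc S).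

Definition unlinked S i j p := ~~ has (linked S i j p) (iota 0 n).

(** A chain has only two ends, so vertices already linked in these colours are excluded. *)
Definition candidates S i j p :=
  [seq q <- iota 0 n | [&& q != p, isend S i j q & unlinked S i j q]].

Definition add_arc S i j p q := Position (pcol S) (pmis S) ((i, j, p, q) :: parc S).

Definition set_col S e c i b := Position
  (fun f => if f == e then c else pcol S f)
  (fun p l => if (l == i) && ((p == src e) || (p == tgt e)) then b else pmis S p l)
  (parc S).

(** Exchanging [i] and [j] preserves the vertex sets of the chains in these two colours and does not
    touch chains in two other colours. A chain using just one of them may be rerouted, so its arc is
    forgotten. *)
Definition do_swap S i j (X : seq nat) := Position
  (fun e => if pcol S e is Some l then Some (if src e \in X then swap2 i j l else l) else None)
  (fun p l => if p \in X then pmis S p (swap2 i j l) else pmis S p l)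
  [seq r <- parc S | let: (i', j', _, _) := r in
     ((i' == i) && (j' == j)) || [&& i' != i, i' != j, j' != i & j' != j]].

(** [X] has to account for whole components: an end comes with its partner, and a named edge in one
    of the two colours does not leave [X]. A vertex with unnamed edges in both colours is refused,
    as the chain running through it has unknown ends. *)
Definition swap_ok S i j (X : seq nat) :=
  [&& i < k, j < k, i != j,
      all (fun p => [&& p < n, ~~ (halfedge S p i && halfedge S p j)
        & isend S i j p ==> has (linked S i j p) X]) X
    & all (fun e => ((pcol S e == Some i) || (pcol S e == Some j)) ==>
        ((src e \in X) == (tgt e \in X))) (iota 0 (size el))].

Fixpoint check S (s : strategy) {struct s} : bool :=
  match s with
  | Goal => goal S
  | Unc e s => (e < size el) &&
      if pcol S e is Some i then check (set_col S e None i true) s else false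
  | Col e i s => [&& e < size el, i < k, pcol S e == None, pmis S (src e) i, pmis S (tgt e) i
      & check (set_col S e (Some i) i false) s]
  | Fol i j p ss => [&& i < k, j < k, p < n, isend S i j p, unlinked S i j p
      & (fix go (qs : seq nat) (ss : seq strategy) {struct ss} := match qs, ss with
         | [::], _ => true
         | q :: qs, s :: ss => check (add_arc S i j p q) s && go qs ss
         | _, _ => false
         end) (candidates S i j p) ss]
  | Swp i j X s => swap_ok S i j X && check (do_swap S i j X) s
  end.

(** * Meaning of a position, and soundness of the moves *)

Variables (T I : finType) (V : nat -> T) (C : nat -> I) (E : rel T).
Hypotheses (elP : all (fun e : nat * nat => e.1 < e.2 < n) el && uniq el).
Hypotheses (Esym : symmetric E) (Eirr : irreflexive E).
Hypothesis V_inj : forall p q, p < n -> q < n -> V p = V q -> p = q.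
Hypothesis C_inj : forall i j, i < k -> j < k -> C i = C j -> i = j.

Definition ends e x y := (x = V (src e) /\ y = V (tgt e)) \/ (x = V (tgt e) /\ y = V (src e)).

Definition named (x y : T) :=
  has (fun e : nat * nat => ((V e.1 == x) && (V e.2 == y)) || ((V e.1 == y) && (V e.2 == x))) el.

(** The named edges are removed whatever their current colour. Recolouring them therefore changes no
    outer chain, and recorded arcs stay valid. *)
Definition outer (m : I -> T -> T) c z := if named z (m c z) then z else m c z.

Definition outer_chain m i j := chain (outer m (C i)) (outer m (C j)).
Definition outer_end m i j := chain_end (outer m (C i)) (outer m (C j)).

(** The clause that keeps the game finite is [d_out]: an unnamed vertex misses all colours of the
    game or none, so no chain ends there. *)
Record describes (S : position) (m : I -> T -> T) : Prop := Describes {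
  d_proper : proper_family m;
  d_edge : forall c x, m c x != x -> E x (m c x);
  d_all : forall x y, E x y -> (exists c, m c x = y) \/
    exists e, [/\ e < size el, pcol S e = None & ends e x y];
  d_col : forall e, e < size el -> if pcol S e is Some i then i < k /\ m (C i) (V (src e)) = V (tgt e)
     else forall c, m c (V (src e)) != V (tgt e);
  d_mis : forall p i, p < n -> i < k -> (m (C i) (V p) == V p) = pmis S p i;
  d_out : forall z, (forall p, p < n -> V p != z) -> forall i j, i < k -> j < k ->
    (m (C i) z == z) = (m (C j) z == z);
  d_arc : forall i j p q, (i, j, p, q) \in parc S ->
    [/\ i < k, j < k, p < n, q < n & p != q] /\
    [/\ outer_end m i j (V p), outer_end m i j (V q) & connect (outer_chain m i j) (V p) (V q)]
}.

Lemma srcP e : e < size el -> [/\ src e < n, tgt e < n & src e < tgt e].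
Proof.
move=> es; have /andP[/allP elP' _] := elP.
by case/andP: (elP' _ (mem_nth (0, 0) es)) => h1 h2; rewrite (ltn_trans h1).
Qed.

Lemma src_tgt e : e < size el -> V (src e) != V (tgt e).
Proof.
case/srcP=> s1 t1; apply: contraTneq => /V_inj-> //.
by rewrite ltnn.
Qed.

Lemma namedP x y : reflect (exists2 e, e < size el & ends e x y) (named x y).
Proof.
apply: (iffP hasP) => [[e /(nthP (0, 0))[i iE <-]]|[e es eE]].
  by case/orP=> /andP[/eqP<- /eqP<-]; exists i => //; [left|right].
exists (nth (0, 0) el e); first exact: mem_nth.
by case: eE => -[-> ->]; rewrite /src /tgt !eqxx ?orbT.
Qed.

Lemma named_sym x y : named x y = named y x.
Proof. by apply: eq_has => e; rewrite orbC. Qed.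

Lemma ends_inj e f x y : e < size el -> f < size el -> ends e x y -> ends f x y -> e = f.
Proof.
move=> es fs; have [se te le] := srcP es; have [sf tf lf] := srcP fs.
have /andP[_ elU] := elP.
have key : src e = src f -> tgt e = tgt f -> e = f.
  move=> h1 h2; apply/eqP; rewrite -(nth_uniq (0, 0) es fs elU); apply/eqP.
  by rewrite [LHS]surjective_pairing [RHS]surjective_pairing; congr pair.
case=> -[-> ->] [] [] /V_inj h1 /V_inj h2.
- by apply: key; [exact: h1|exact: h2].
- by have := h1 se tf; have := h2 te sf; lia.
- by have := h1 te sf; have := h2 se tf; lia.
by apply: key; [exact: h2|exact: h1].
Qed.

Lemma outerK m c : proper_family m -> involutive (outer m c).
Proof.
move=> [mK _] z; rewrite /outer; case nz: (named z (m c z)); first by rewrite nz.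
by rewrite mK named_sym nz.
Qed.

Section Sound.
Variables (S : position) (m : I -> T -> T).
Hypothesis Sm : describes S m.

Lemma halfedgeP p i : p < n -> i < k -> (outer m (C i) (V p) != V p) = halfedge S p i.
Proof.
move=> pn ik; have [mK mI] := d_proper Sm.
rewrite /halfedge -(d_mis Sm pn ik) /outer.
case: (eqVneq (m (C i) (V p)) (V p)) => [->|mp]; first by rewrite if_same eqxx.
case: namedP => [[e es eE]|none] /=; last first.
  rewrite mp; apply/esym/hasPn => e; rewrite mem_iota add0n => /andP[_ es].
  apply/negP=> /andP[/eqP ce pe]; apply: none; exists e => //.
  have := d_col Sm es; rewrite ce => -[_ me].
  case/orP: pe => /eqP <-; first by left; rewrite me.
  by right; rewrite -me mK me.
rewrite eqxx; apply/esym/negbF/hasP; exists e; first by rewrite mem_iota.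
have [se te _] := srcP es.
have := d_col Sm es; case ce: (pcol S e) => [l|].
  case=> lk me.
  have il : C i = C l.
    case: eE => -[pe qe].
      by apply: (mI _ _ (V (src e))); rewrite ?me -pe //; apply/eqP.
    have me' : m (C l) (V (tgt e)) = V (src e) by rewrite -me mK.
    by apply: (mI _ _ (V (tgt e))); rewrite ?me' -pe //; apply/eqP.
  rewrite (C_inj ik lk il) eqxx /=.
  by case: eE => -[pe _]; rewrite (V_inj _ _ pe) // eqxx ?orbT.
move=> none; case: eE => -[pe qe].
  by have := none (C i); rewrite -pe qe eqxx.
by have := none (C i); rewrite -qe mK pe eqxx.
Qed.

Lemma isendP i j p : i < k -> j < k -> p < n -> outer_end m i j (V p) = isend S i j p.
Proof.
move=> ik jk pn; rewrite /isend -!halfedgeP // /outer_end /chain_end.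
by case: (outer m (C i) (V p) == V p); case: (outer m (C j) (V p) == V p).
Qed.

(** No named edge meets an unnamed vertex, and by [d_out] both colours move it or neither does. *)
Lemma outer_end_named i j z : i < k -> j < k -> outer_end m i j z -> exists2 p, p < n & z = V p.
Proof.
have [/existsP[p /eqP->]|/existsPn none] := boolP [exists p : 'I_n, z == V p].
  by exists p.
have zn p : p < n -> V p != z by move=> pn; rewrite eq_sym (none (Ordinal pn)).
have nz y : named z y = false.
  apply/namedP => -[e es [][ze _]]; have [se te _] := srcP es.
    by have := zn _ se; rewrite ze eqxx.
  by have := zn _ te; rewrite ze eqxx.
by move=> ik jk; rewrite /outer_end /chain_end /outer !nz (d_out Sm zn ik jk) eqxx.
Qed.


(** Parity gives the other end. Had it been linked before to some [r], then [p], [q] and [r] would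
    be three ends of one component. *)
Lemma fol_sound i j p : i < k -> j < k -> p < n -> isend S i j p -> unlinked S i j p ->
  exists2 q, q \in candidates S i j p & describes (add_arc S i j p q) m.
Proof.
move=> ik jk pn pe pu; have [mK mI] := d_proper Sm.
have fK := outerK (C i) (d_proper Sm); have gK := outerK (C j) (d_proper Sm).
have pE : outer_end m i j (V p) by rewrite isendP.
have [y [yp yE cy]] := chain_end_partner fK gK pE.
have [q qn yq] := outer_end_named ik jk yE; rewrite {y}yq in yp yE cy.
have qp : q != p by apply: contraNneq yp => ->.
exists q.
  have qe : isend S i j q by rewrite -isendP.
  rewrite mem_filter qp mem_iota add0n qn qe /= andbT.
  apply/hasPn => r; rewrite mem_iota add0n => /andP[_ rn].
  apply/negP => qr.
  have [[_ _ _ _ rq] [_ rE cr]] : [/\ i < k, j < k, q < n, r < n & r != q] /\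
    [/\ outer_end m i j (V q), outer_end m i j (V r) & connect (outer_chain m i j) (V q) (V r)].
    case/orP: qr => /(d_arc Sm) [[_ _ h1 h2 h3] [h4 h5 h6]]; split; split => //.
      by rewrite eq_sym.
    by rewrite (connect_chain_sym fK gK).
  have rp : r != p.
    apply: contraTneq pu => rp; apply/negPn/hasP; exists q; first by rewrite mem_iota.
    by rewrite -rp /linked orbC.
  have := chain_end_unique fK gK pE yE rE yp.
  case/(_ _ cy (connect_trans cy cr))/(V_inj rn qn)/eqP/idPn => //.
  by apply: contraNneq rp => /(V_inj rn pn) ->.
split=> //=; try by case: Sm.
move=> i' j' p' q'; rewrite inE => /orP[/eqP[-> -> -> ->]|]; last exact: (d_arc Sm).
by rewrite [p == q]eq_sym.
Qed.

Lemma arc_transport m' i j p q : outer m' (C i) =1 outer m (C i) -> outer m' (C j) =1 outer m (C j) ->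
  (i, j, p, q) \in parc S ->
  [/\ i < k, j < k, p < n, q < n & p != q] /\
  [/\ outer_end m' i j (V p), outer_end m' i j (V q) & connect (outer_chain m' i j) (V p) (V q)].
Proof.
move=> ei ej /(d_arc Sm) [h [p1 p2 p3]]; split=> //; split.
- by rewrite /outer_end /chain_end ei ej.
- by rewrite /outer_end /chain_end ei ej.
rewrite (eq_connect (e' := outer_chain m i j)) // => x y.
by rewrite /outer_chain /chain /= ei ej.
Qed.

Lemma outer_named m' c z y : named z y -> m' c z = y \/ m' c z = z -> outer m' c z = z.
Proof. by rewrite /outer => zy [] ->; rewrite ?zy ?if_same. Qed.

Lemma unc_sound e i : e < size el -> pcol S e = Some i ->
  describes (set_col S e None i true) (uncolour m (C i) (V (src e)) (V (tgt e))).
Proof.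
move=> es ce; have [mK mI] := d_proper Sm; have [se te _] := srcP es.
have := d_col Sm es; rewrite ce => -[ik me].
have me' : m (C i) (V (tgt e)) = V (src e) by rewrite -me mK.
set u := V (src e) in me me' *; set v := V (tgt e) in me me' *.
have uv : u != v by apply: src_tgt.
have nuv : named u v by apply/namedP; exists e => //; left.
(* The edge is named, hence invisible to [outer]; this is why every arc persists. *)
have oE c : outer (uncolour m (C i) u v) c =1 outer m c.
  move=> z; rewrite {1}/outer /uncolour.
  case: (boolP ((c == C i) && _)) => [/andP[/eqP-> /orP[]/eqP->]|_ //]; rewrite if_same.
    by rewrite (outer_named nuv) //; left.
  by rewrite (@outer_named m _ v u) 1?named_sym //; left.
have VE p c : p < n -> (V p == c) -> c = V p by move=> _ /eqP.
split=> /=.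
- exact: uncolour_proper (d_proper Sm) me.
- move=> c x; rewrite /uncolour; case: ifP => [_|_]; [by rewrite eqxx|exact: (d_edge Sm)].
- move=> x y /(d_all Sm) [[c mx]|[f [fs cf ef]]]; last first.
    by right; exists f; split=> //; rewrite cf if_same.
  rewrite /uncolour; have [ci|ci] := eqVneq c (C i); last first.
    by left; exists c; rewrite (negPf ci).
  rewrite ci in mx; have [xu|xu] := eqVneq x u.
    right; exists e; split; rewrite ?eqxx //; left; split=> //.
    by rewrite -mx xu.
  have [xv|xv] := eqVneq x v.
    right; exists e; split; rewrite ?eqxx //; right; split=> //.
    by rewrite -mx xv.
  by left; exists c; rewrite andbF ci.
- move=> f fs; have [->|fe] := eqVneq f e.
    move=> c; rewrite /uncolour -/u -/v eqxx /= andbT.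
    case: (eqVneq c (C i)) => // ci; apply: contraNneq ci => mc; apply/eqP.
    by apply: (mI _ _ u); rewrite ?me // mc; apply/eqP; rewrite eq_sym.
  have := d_col Sm fs; case: (pcol S f) => [l|none c]; last first.
    rewrite /uncolour; case: ifP => _; [exact: src_tgt|exact: none].
  move=> [lk mf]; split=> //; rewrite /uncolour; case: ifP => [/andP[/eqP il]|_ //].
  rewrite il in mf; case/orP => /eqP fu; case/eqP: fe;
    apply: (ends_inj (x := u) (y := v)) => //; try by left.
    by left; rewrite -me -fu mf.
  by right; rewrite -me' -fu mf.
- move=> p l pn lk; rewrite /uncolour -(d_mis Sm) //.
  have -> : (l == i) = (C l == C i) by apply/eqP/eqP => [->|/C_inj->].
  have Vs q : q < n -> (p == q) = (V p == V q) by move=> qn; apply/eqP/eqP => [->|/V_inj->].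
  by rewrite !Vs // -/u -/v; case: ifP; rewrite ?eqxx.
- move=> z zn i' j' ik' jk'; rewrite /uncolour.
  have [zu|zu] := eqVneq z u; first by have := zn _ se; rewrite zu eqxx.
  have [zv|zv] := eqVneq z v; first by have := zn _ te; rewrite zv eqxx.
  by rewrite !andbF; apply: (d_out Sm).
by move=> i' j' p q; apply: arc_transport.
Qed.

Lemma col_sound e i : e < size el -> i < k -> pcol S e = None -> pmis S (src e) i -> pmis S (tgt e) i ->
  E (V (src e)) (V (tgt e)) ->
  describes (set_col S e (Some i) i false) (colour m (C i) (V (src e)) (V (tgt e))).
Proof.
move=> es ik ce; have [mK mI] := d_proper Sm; have [se te _] := srcP es.
rewrite -!(d_mis Sm) //; have := d_col Sm es; rewrite ce.
set u := V (src e); set v := V (tgt e) => none /eqP mu /eqP mv Euv.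
have uv : u != v by apply: src_tgt.
have nuv : named u v by apply/namedP; exists e => //; left.
have oE c : outer (colour m (C i) u v) c =1 outer m c.
  move=> z; rewrite {1}/outer /colour.
  case: (eqVneq c (C i)) => [->|_ //].
  case: (eqVneq z u) => [->|zu]; first by rewrite nuv (outer_named nuv) //; right.
  case: (eqVneq z v) => [->|zv //].
  by rewrite named_sym nuv (@outer_named m _ v u) 1?named_sym //; right.
split=> /=.
- exact: colour_proper (d_proper Sm) uv mu mv none.
- move=> c x; rewrite /colour; case: ifP => _; last exact: (d_edge Sm).
  case: (eqVneq x u) => [->|_]; first by [].
  by case: (eqVneq x v) => [->|_]; [rewrite Esym | apply: (d_edge Sm)].
- move=> x y Exy; have /(d_all Sm) [[c mx]|[f [fs cf ef]]] := Exy.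
    left; exists c; rewrite /colour; case: (eqVneq c (C i)) => // ci; rewrite ci in mx.
    case: (eqVneq x u) => [xu|_]; first by rewrite -mx xu mu Eirr in Exy.
    by case: (eqVneq x v) => [xv|_]; [rewrite -mx xv mv Eirr in Exy | rewrite ci].
  have [fe|fe] := eqVneq f e; last by right; exists f; rewrite (negPf fe).
  left; exists (C i); rewrite /colour eqxx; rewrite fe in ef.
  case: ef => -[-> ->]; rewrite -/u -/v eqxx // eq_sym (negPf uv).
  by [].
- move=> f fs; have [->|fe] := eqVneq f e.
    by split=> //; rewrite /colour !eqxx.
  have := d_col Sm fs; case: (pcol S f) => [l|nonef c].
    move=> [lk mf]; split=> //; rewrite /colour; case: (eqVneq (C l) (C i)) => // il.
    rewrite il in mf; case: (eqVneq _ u) => [fu|_].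
      by have := src_tgt fs; rewrite -mf fu mu eqxx.
    case: (eqVneq _ v) => [fv|_]; last by rewrite il.
    by have := src_tgt fs; rewrite -mf fv mv eqxx.
  rewrite /colour; case: (eqVneq c (C i)) => [_|_]; last exact: nonef.
  case: (eqVneq _ u) => [fu|_].
    apply: contra fe => /eqP vt; apply/eqP; apply: (ends_inj (x := u) (y := v)) => //; try by left.
  case: (eqVneq _ v) => [fv|_]; last exact: nonef.
  apply: contra fe => /eqP vt; apply/eqP; apply: (ends_inj (x := u) (y := v)) => //; first by right.
  by left.
- move=> p l pn lk; rewrite /colour -(d_mis Sm) //.
  have -> : (l == i) = (C l == C i) by apply/eqP/eqP => [->|/C_inj->].
  have Vs q : q < n -> (p == q) = (V p == V q) by move=> qn; apply/eqP/eqP => [->|/V_inj->].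
  rewrite !Vs // -/u -/v; case: (C l == C i) => //=.
  case: (eqVneq (V p) u) => [->|_] /=; first by rewrite eq_sym (negPf uv).
  by case: (eqVneq (V p) v) => [->|_] /=; first by rewrite (negPf uv).
- move=> z zn i' j' ik' jk'; rewrite /colour.
  have [zu|zu] := eqVneq z u; first by have := zn _ se; rewrite zu eqxx.
  have [zv|zv] := eqVneq z v; first by have := zn _ te; rewrite zv eqxx.
  by rewrite !if_same; apply: (d_out Sm).
by move=> i' j' p q; apply: arc_transport.
Qed.


Lemma incident_halfedge e l p : e < size el -> pcol S e = Some l -> (src e == p) || (tgt e == p) ->
  halfedge S p l = false.
Proof.
move=> es ce ep; apply/negbTE/nandP; right; rewrite negbK; apply/hasP; exists e.
  by rewrite mem_iota.
by rewrite ce eqxx ep.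
Qed.

Lemma named_col e l x : e < size el -> l < k -> ends e x (m (C l) x) -> pcol S e = Some l.
Proof.
move=> es lk eE; have [mK mI] := d_proper Sm.
have st := src_tgt es; have := d_col Sm es; case: (pcol S e) => [l'|none].
  case=> lk' me; congr Some; apply: C_inj => //.
  have me' : m (C l') (V (tgt e)) = V (src e) by rewrite -me mK.
  case: eE => -[xe mx]; rewrite xe in mx.
    by apply: (mI _ _ (V (src e))); [rewrite me mx | apply/eqP; rewrite me eq_sym].
  by apply: (mI _ _ (V (tgt e))); [rewrite me' mx | apply/eqP; rewrite me'].
case: eE => -[xe mx]; rewrite xe in mx; have := none (C l).
  by rewrite mx eqxx.
by rewrite -mx mK eqxx.
Qed.

Section Swap.
Variables (i j : nat) (X : seq nat).
Hypothesis ok : swap_ok S i j X.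

Let ik : i < k. Proof. by case/and5P: ok. Qed.
Let jk : j < k. Proof. by case/and5P: ok. Qed.
Let ij : i != j. Proof. by case/and5P: ok. Qed.

Let XP p : p \in X -> [/\ p < n, ~~ (halfedge S p i && halfedge S p j)
  & isend S i j p -> exists2 q, q \in X & linked S i j p q].
Proof.
case/and5P: ok => _ _ _ /allP okX _ /okX /and3P[pn ns /implyP lk]; split=> // pe.
by apply/hasP/lk.
Qed.

Let Xclosed e : e < size el -> (pcol S e == Some i) || (pcol S e == Some j) ->
  (src e \in X) = (tgt e \in X).
Proof.
case/and5P: ok => _ _ _ _ /allP okE es; have := okE e; rewrite mem_iota es.
by move=> /(_ isT)/implyP h /h /eqP.
Qed.

Let fK := outerK (C i) (d_proper Sm).
Let gK := outerK (C j) (d_proper Sm).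

Lemma connect_halfedge p z : p < n -> z != V p -> connect (outer_chain m i j) (V p) z ->
  halfedge S p i || halfedge S p j.
Proof.
move=> pn zp /connectP[[|y s] /=]; first by move=> _ zE; rewrite zE eqxx in zp.
rewrite -!halfedgeP // => /andP[/andP[py /orP[]/eqP yE] _ _]; rewrite yE [y == _]eq_sym py ?orbT //.
Qed.

(** A vertex [r] that the chain does not run through is one of its ends. So [r] is [p] or the
    partner of [p], which [swap_ok] places in [X]. *)
Lemma swap_region p r : p \in X -> r < n -> ~~ (halfedge S r i && halfedge S r j) ->
  connect (outer_chain m i j) (V p) (V r) -> r \in X.
Proof.
move=> pX rn rs pr; have [pn ps pl] := XP pX.
have [-> //|rp] := eqVneq r p.
have Vrp : V r != V p by apply: contraNneq rp => /(V_inj rn pn) ->.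
have endI q : ~~ (halfedge S q i && halfedge S q j) -> halfedge S q i || halfedge S q j ->
  isend S i j q by rewrite /isend; do 2 case: halfedge.
have pe := endI _ ps (connect_halfedge pn Vrp pr).
have re : isend S i j r.
  apply: endI rs (connect_halfedge (z := V p) rn _ _); first by rewrite eq_sym.
  by rewrite (connect_chain_sym fK gK).
have [q qX pq] := pl pe; have [qn _ _] := XP qX.
suff [qp qE cq] : [/\ q != p, outer_end m i j (V q) & connect (outer_chain m i j) (V p) (V q)].
  have Vqp : V q != V p by apply: contraNneq qp => /(V_inj qn pn) ->.
  have pE : outer_end m i j (V p) by rewrite isendP.
  have rE : outer_end m i j (V r) by rewrite isendP.
  by rewrite (V_inj rn qn (chain_end_unique fK gK pE qE rE Vqp Vrp cq pr)).
case/orP: pq => /(d_arc Sm) [[_ _ _ _ h] [h1 h2 h3]]; split=> //.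
  by rewrite eq_sym.
by rewrite (connect_chain_sym fK gK).
Qed.

(** Connectivity is along unnamed edges only; closure under the named ones comes from [Xclosed]. *)
Definition region z := has (fun p => connect (outer_chain m i j) (V p) z) X.

Lemma regionE r : r < n -> ~~ (halfedge S r i && halfedge S r j) -> region (V r) = (r \in X).
Proof.
move=> rn rs; apply/hasP/idP => [[p pX]|rX]; first exact: swap_region.
by exists r => //; apply: connect0.
Qed.

(** An unnamed edge continues the chain. The ends of a named edge have no half-edge in its colour,
    so [regionE] reduces the claim to membership in [X], which is the same for both. *)
Lemma regionW l z : (l == i) || (l == j) -> region z -> region (m (C l) z).
Proof.
move=> lij zX; have lk : l < k by case/orP: lij => /eqP->.
have [nz|nz] := boolP (named z (m (C l) z)); last first.
  case/hasP: zX => p pX pz; apply/hasP; exists p => //; apply: connect_trans pz _.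
  have -> : m (C l) z = outer m (C l) z by rewrite /outer (negPf nz).
  by case/orP: lij => /eqP->; [apply: connect_chain_l | apply: connect_chain_r].
have [e es eE] := namedP _ _ nz; have [se te _] := srcP es.
have ce := named_col es lk eE.
have ns r : (src e == r) || (tgt e == r) -> ~~ (halfedge S r i && halfedge S r j).
  move=> er; have := incident_halfedge es ce er.
  by case/orP: lij => /eqP-> ->; rewrite ?andbF.
have cl : (src e \in X) = (tgt e \in X).
  by apply: Xclosed => //; rewrite ce; case/orP: lij => /eqP->; rewrite eqxx ?orbT.
by case: eE zX => -[-> ->]; rewrite !regionE // ?ns ?eqxx ?orbT // cl.
Qed.

Lemma region_stable l z : (l == i) || (l == j) -> region (m (C l) z) = region z.
Proof.
move=> lij; apply/idP/idP; last exact: regionW.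
by move/(regionW lij); rewrite (proj1 (d_proper Sm)).
Qed.

Lemma swap2C l : l < k -> swap2 (C i) (C j) (C l) = C (swap2 i j l).
Proof.
move=> lk; rewrite /swap2; have -> : (C l == C i) = (l == i).
  by apply/eqP/eqP => [/(C_inj lk ik)->|->].
have -> : (C l == C j) = (l == j) by apply/eqP/eqP => [/(C_inj lk jk)->|->].
by case: (l == i); case: (l == j).
Qed.

Lemma swap2_lt l : l < k -> swap2 i j l < k.
Proof. by rewrite /swap2; case: (l == i); case: (l == j). Qed.

Lemma swap_sound : describes (do_swap S i j X) (kempe m (C i) (C j) region).
Proof.
have mP := d_proper Sm; have [mK mI] := mP.
have ri z : region (m (C i) z) = region z by apply: region_stable; rewrite eqxx.
have rj z : region (m (C j) z) = region z by apply: region_stable; rewrite eqxx orbT.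
set m' := kempe _ _ _ _.
have m'E l z : l < k -> m' (C l) z = m (C (if region z then swap2 i j l else l)) z.
  by move=> lk; rewrite /m' kempeE swap2C // -fun_if.
split=> /=.
- exact: kempe_proper.
- by move=> c x; rewrite /m' kempeE; apply: (d_edge Sm).
- move=> x y /(d_all Sm) [[c mx]|[e [es ce ee]]]; last by right; exists e; rewrite ce.
  left; exists (if region x then swap2 (C i) (C j) c else c); rewrite /m' kempeE.
  by case: (region x); rewrite ?swap2K.
- move=> e es; have [se te _] := srcP es; have := d_col Sm es.
  case ce: (pcol S e) => [l|]; last by move=> none c; rewrite /m' kempeE.
  case=> lk me; split; first by case: ifP => // _; apply: swap2_lt.
  rewrite m'E; last by case: ifP => // _; apply: swap2_lt.
  have [lij|/norP[li lj]] := boolP ((l == i) || (l == j)); last first.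
    by rewrite !(swap2_id li lj) // !if_same swap2_id // if_same.
  have -> : region (V (src e)) = (src e \in X).
    apply: regionE => //; have := incident_halfedge (p := src e) es ce; rewrite eqxx => /(_ isT).
    by case/orP: lij => /eqP-> ->; rewrite ?andbF.
  by case: (src e \in X); rewrite ?swap2K.
- move=> p l pn lk; rewrite m'E // (d_mis Sm) //; last by case: ifP => // _; apply: swap2_lt.
  (* A vertex with unnamed edges in both colours misses neither, so it is irrelevant whether the
     region contains it. *)
  have [/andP[hi hj]|ns] := boolP (halfedge S p i && halfedge S p j); last first.
    by rewrite regionE //; case: ifP.
  have [/andP[/negbTE mi _] /andP[/negbTE mj _]] := (hi, hj).
  suff pE : pmis S p (swap2 i j l) = pmis S p l.
    by case: (region _); case: (p \in X); rewrite ?pE.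
  rewrite /swap2; case: (eqVneq l i) => [->|_]; first by rewrite mi mj.
  by case: (eqVneq l j) => [->|_ //]; rewrite mi mj.
- move=> z zn l l' lk lk'; rewrite !m'E //; apply: (d_out Sm) => //.
    by case: ifP => // _; apply: swap2_lt.
  by case: ifP => // _; apply: swap2_lt.
move=> i' j' p q; rewrite mem_filter => /andP[].
case/orP=> [/andP[/eqP-> /eqP->]|/and4P[ii ij' ji jj]] arc; last first.
  have [[ik' jk' _ _ _] _] := d_arc Sm arc.
  have Cne l l' : l < k -> l' < k -> l != l' -> C l != C l'.
    by move=> lk lk'; apply: contraNneq => /(C_inj lk lk') ->.
  by apply: arc_transport => // z; rewrite /outer /m' kempe_other // Cne.
(* On the region the two outer matchings trade places, which leaves their union and its ends
   unchanged. *)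
have oE z : (outer m' (C i) z = outer m (C (if region z then j else i)) z) /\
            (outer m' (C j) z = outer m (C (if region z then i else j)) z).
  by rewrite /outer !m'E // swap2l swap2r.
have [h [h1 h2 h3]] := d_arc Sm arc; split=> //.
have eE z : outer_end m' i j z = outer_end m i j z.
  rewrite /outer_end /chain_end; have [-> ->] := oE z.
  by case: (region z) => //; rewrite eq_sym.
split; rewrite ?eE //; rewrite (eq_connect (e' := outer_chain m i j)) // => x y.
rewrite /outer_chain /chain /=; have [-> ->] := oE x.
by case: (region x); rewrite // orbC.
Qed.

End Swap.

End Sound.

Hypothesis elE : forall e, e < size el -> E (V (src e)) (V (tgt e)).

(** At a [Fol] only the continuation for the actual end of the chain is played; all candidates are
    checked because that end is not known beforehand. *)
Theorem check_sound s S m : describes S m -> check S s -> exists S' m', describes S' m' /\ goal S'.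
Proof.
elim/strategy_ind': s S m => [|e s IHs|e i s IHs|i j p ss IHss|i j X s IHs] S m Sm /=.
- by exists S, m.
- case/andP=> es; case ce: (pcol S e) => [i|//].
  exact/IHs/(unc_sound Sm es ce).
- case/and5P=> es ik /eqP ce sm /andP[tm].
  exact/IHs/(col_sound Sm es ik ce sm tm (elE es)).
- case/and5P=> ik jk pn pe /andP[pu].
  have [q] := fol_sound Sm ik jk pn pe pu.
  elim: (candidates S i j p) ss IHss => //= q' qs IHqs [//|s ss] [IHs IHss].
  rewrite inE => /orP[/eqP->|qqs] Sm' /andP[cs css]; first exact: (IHs _ _ Sm').
  exact: (IHqs ss).
case/andP=> ok; exact/IHs/(swap_sound Sm ok).
Qed.

End Game.

(** * Winning strategies *)

(** Vertices beyond the end of [miss] miss no colour; [u] and [w] enter in this way. *)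
Definition opening (cols : seq nat) (miss : seq (seq nat)) := Position
  (fun e => Some (nth 0 cols e)) (fun p l => l \in nth [::] miss p) [::].

Definition all_coloured (el : seq (nat * nat)) (S : position) :=
  all (fun e => pcol S e != None) (iota 0 (size el)).

(** Vertices 0 and 1 are [v1] and [v2]: the common colour would fit [v1 v2], against [r_stuck]. *)
Definition shared k el S := all_coloured el S && has (fun i => pmis S 0 i && pmis S 1 i) (iota 0 k).

(** Vertices 0 and 1 are [a] and [v2]: a colour missing at [a] but not at [v2] is given to
    [v1 a]. *)
Definition different k el S := all_coloured el S && has (fun i => pmis S 0 i && ~~ pmis S 1 i) (iota 0 k).

(* The next four strategies were found by computer search.  In the first two the vertices
   are numbered [v1], [v2], [x], [y], [u]; in the other two [a], [v2], [x], [y],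
   [u], [w], after [v1 a] has been uncoloured. *)
Definition path_here_strategy := Fol 0 1 0 [::
 Unc 1 (Unc 0 (Col 0 1 (Fol 0 2 0 [::
  Fol 0 2 3 [::
   Unc 0 (Col 0 0 (Swp 0 2 [:: 1;3;4] (Col 1 1 (Goal))))];
  Fol 0 2 2 [::
   Unc 0 (Col 0 0 (Swp 0 2 [:: 1;2;4] (Col 1 1 (Goal))))];
  Fol 0 2 2 [::
   Swp 0 2 [:: 0;4] (Col 1 2 (Goal))]])))].

(** Colours 0 and 1 are on [v2 u] and [x u], colour 2 is missing at [v2], [x] and [y]. Here [v2]
    also misses the colour of [x u]. *)
Lemma path_here_wins : check 5 3 [:: (1, 4); (2, 4)] (shared 3 [:: (1, 4); (2, 4)])
  (opening [:: 0; 1] [:: [:: 0]; [:: 1; 2]; [:: 2]; [:: 2]]) path_here_strategy.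
Proof. by vm_compute. Qed.

Definition path_there_strategy := Fol 1 2 0 [::
 Fol 1 2 3 [::
  Swp 1 2 [:: 2;3;4] (Fol 0 2 0 [::
   Unc 1 (Unc 0 (Col 0 2 (Fol 1 3 0 [::
    Fol 1 3 2 [::
     Swp 1 3 [:: 2;3] (Fol 0 3 0 [::
      Fol 0 3 3 [::
       Unc 0 (Col 0 0 (Swp 0 3 [:: 1;3;4] (Col 1 2 (Goal))))];
      Fol 0 3 2 [::
       Unc 0 (Col 0 0 (Swp 0 3 [:: 1;2;4] (Col 1 2 (Goal))))];
      Fol 0 3 2 [::
       Swp 0 3 [:: 0;4] (Col 1 3 (Goal))]])];
    Fol 1 3 1 [::
     Unc 0 (Col 0 0 (Swp 1 3 [:: 1;3] (Col 1 2 (Goal))))];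
    Fol 1 3 1 [::
     Unc 0 (Col 0 0 (Swp 1 3 [:: 0;3] (Col 1 2 (Goal))))]])))])];
 Fol 1 2 1 [::
  Swp 1 2 [:: 0;3] (Goal)];
 Fol 1 2 1 [::
  Swp 1 2 [:: 1;3] (Goal)]].

(** Now [v1] misses the colour of [x u]; colour 3 is a second colour missing at [v2]. *)
Lemma path_there_wins : check 5 4 [:: (1, 4); (2, 4)] (shared 4 [:: (1, 4); (2, 4)])
  (opening [:: 0; 1] [:: [:: 0; 1]; [:: 2; 3]; [:: 2]; [:: 2]]) path_there_strategy.
Proof. by vm_compute. Qed.

Definition kite_strategy := Fol 0 4 0 [::
 Fol 0 4 2 [::
  Swp 0 4 [:: 2;3;4] (Fol 0 3 0 [::
   Fol 0 3 2 [::
    Fol 2 4 1 [::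
     Fol 2 4 3 [::
      Swp 0 3 [:: 2;3;4] (Fol 0 2 0 [::
       Unc 2 (Unc 1 (Col 1 0 (Swp 2 4 [:: 3;4] (Col 2 4 (Goal)))))])];
     Fol 2 4 2 [::
      Unc 1 (Swp 2 4 [:: 2;4] (Fol 0 4 0 [::
       Unc 3 (Col 3 4 (Col 1 0 (Goal)))]))];
     Fol 2 4 2 [::
      Swp 2 4 [:: 2;3] (Fol 0 2 0 [::
       Unc 3 (Unc 1 (Col 3 2 (Col 1 0 (Goal))))])]]];
   Fol 0 3 1 [::
    Fol 1 4 0 [::
     Fol 1 4 3 [::
      Unc 2 (Swp 0 3 [:: 1;3;4] (Unc 0 (Col 0 0 (Swp 1 4 [:: 3;4] (Col 2 4 (Goal))))))];
     Fol 1 4 2 [::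
      Unc 0 (Swp 1 4 [:: 2;4] (Fol 0 4 0 [::
       Unc 3 (Col 3 4 (Col 0 0 (Goal)))]))];
     Fol 1 4 2 [::
      Swp 1 4 [:: 2;3] (Fol 2 3 1 [::
       Fol 0 1 1 [::
        Unc 3 (Unc 0 (Col 3 1 (Col 0 0 (Goal))))]])]]];
   Fol 0 3 1 [::
    Fol 2 4 1 [::
     Fol 2 4 3 [::
      Unc 2 (Swp 0 3 [:: 0;3;4] (Unc 1 (Col 1 0 (Swp 2 4 [:: 3;4] (Col 2 4 (Goal))))))];
     Fol 2 4 2 [::
      Unc 1 (Swp 2 4 [:: 2;4] (Fol 0 4 0 [::
       Unc 3 (Col 3 4 (Col 1 0 (Goal)))]))];
     Fol 2 4 2 [::
      Swp 2 4 [:: 2;3] (Unc 0 (Swp 2 4 [:: 1;2;3;4] (Col 0 1 (Fol 0 4 0 [::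
       Unc 3 (Unc 1 (Col 3 4 (Col 1 0 (Goal))))]))))]]]])];
 Fol 0 4 1 [::
  Swp 0 4 [:: 1;3;4] (Goal)];
 Fol 0 4 1 [::
  Swp 0 4 [:: 0;3;4] (Goal)]].

(** Colour 0 is missing at [a], [v2], [x] and [y], and colours 1 to 4 are on their edges to [u]. *)
Lemma kite_wins : check 5 5 [:: (0, 4); (1, 4); (2, 4); (3, 4)] 
  (different 5 [:: (0, 4); (1, 4); (2, 4); (3, 4)])
  (opening [:: 1; 2; 3; 4] (nseq 4 [:: 0])) kite_strategy.
Proof. by vm_compute. Qed.

Definition broom_strategy := Fol 0 2 0 [::
 Fol 0 2 3 [::
  Swp 0 2 [:: 0;2] (Goal)];
 Fol 0 2 2 [::
  Swp 0 2 [:: 0;3] (Goal)];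
 Fol 0 2 2 [::
  Swp 0 2 [:: 2;3] (Fol 1 2 0 [::
   Fol 1 2 2 [::
    Fol 0 3 0 [::
     Fol 0 3 2 [::
      Swp 0 3 [:: 2;4] (Fol 0 2 0 [::
       Swp 0 2 [:: 0;3] (Goal)])];
     Fol 0 3 1 [::
      Swp 1 2 [:: 2;3] (Fol 4 5 3 [::
       Fol 1 3 0 [::
        Unc 0 (Unc 2 (Col 2 1 (Swp 0 3 [:: 1;4] (Col 0 0 (Goal)))))]])];
     Fol 0 3 1 [::
      Unc 2 (Swp 0 3 [:: 0;4] (Fol 0 2 2 [::
       Swp 0 2 [:: 2;3] (Col 2 0 (Goal))]))]]];
   Fol 1 2 1 [::
    Fol 0 3 0 [::
     Fol 0 3 2 [::
      Unc 0 (Swp 1 2 [:: 0;1;2;3;4] (Fol 0 2 1 [::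
       Fol 1 3 1 [::
        Col 0 2 (Unc 1 (Unc 2 (Col 2 1 (Swp 0 3 [:: 2;4] (Col 1 0 (Goal))))))]]))];
     Fol 0 3 1 [::
      Unc 0 (Swp 1 2 [:: 1;3;4] (Swp 1 2 [:: 1;3;4] (Col 0 1 (Unc 2 (Swp 0 3 [:: 1;4] (Fol 0 4 0 [::
       Unc 0 (Col 0 0 (Swp 1 2 [:: 1;3;4] (Col 2 2 (Goal))))]))))))];
     Fol 0 3 1 [::
      Unc 2 (Swp 0 3 [:: 0;4] (Fol 0 2 2 [::
       Swp 0 2 [:: 2;3] (Col 2 0 (Goal))]))]]];
   Fol 1 2 1 [::
    Unc 0 (Swp 1 2 [:: 0;3] (Fol 0 1 0 [::
     Fol 0 1 3 [::
      Swp 0 1 [:: 3;4] (Col 0 0 (Goal))];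
     Fol 0 1 1 [::
      Swp 0 1 [:: 1;4] (Col 0 0 (Goal))];
     Fol 0 1 1 [::
      Swp 0 1 [:: 0;4] (Fol 0 2 0 [::
       Swp 0 2 [:: 0;2] (Col 0 0 (Goal))])]]))]])]].

(** Colour 0 is missing at [a], [v2], [x] and [y]; colours 1 to 5 are on [a u], [v2 u], [x u], [u w]
    and [y w]. *)
Lemma broom_wins : check 6 6 [:: (0, 4); (1, 4); (2, 4); (4, 5); (3, 5)] 
  (different 6 [:: (0, 4); (1, 4); (2, 4); (4, 5); (3, 5)])
  (opening [:: 1; 2; 3; 4; 5] (nseq 4 [:: 0])) broom_strategy.
Proof. by vm_compute. Qed.


Definition transferred S := has (fun i => pmis S 0 i && pmis S 1 i) (iota 0 2) ||
  has (fun i => [&& pmis S 1 i, pmis S 2 i & pmis S 3 i]) (iota 0 2).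

(** The vertices are [v1], [v2], [x], [y]. If the chain from [x] ends at [v1] or [v2], the exchange
    leaves these two with a common missing colour; if it ends at [y], the colour missing at [v2]
    becomes missing at [x] and [y]. *)
Lemma transfer_wins : check 4 2 [::] transferred
  (opening [::] [:: [:: 0]; [:: 1]; [:: 0]; [:: 0]])
  (Fol 0 1 2 [:: Swp 0 1 [:: 0; 2] Goal; Swp 0 1 [:: 1; 2] Goal; Swp 0 1 [:: 2; 3] Goal]).
Proof. by vm_compute. Qed.

(** * Full colourings and edge deletion *)

Definition neighbours (T : finType) (E : rel T) x : {set T} := [set y | E x y].

Definition delete (T : eqType) (E : rel T) u v : rel T :=
  [rel x y | E x y && ~~ (((x == u) && (y == v)) || ((x == v) && (y == u)))].

Definition complete (T I : finType) (E : rel T) (m : I -> T -> T) : Prop :=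
  [/\ proper_family m, forall c x, m c x != x -> E x (m c x)
    & forall x y, E x y -> exists c, m c x = y].

Section Families.
Variables (T I : finType).
Implicit Types (E : rel T) (m : I -> T -> T).

Lemma complete_proper E m c d x : complete E m -> m c x = m d x -> m c x != x -> c = d.
Proof. by case=> [[_ mI] _ _] e /eqP; apply: mI. Qed.

Lemma completeK E m c : complete E m -> involutive (m c).
Proof. by case=> [[mK _] _ _]. Qed.

Lemma eq_complete E E' m : E =2 E' -> complete E m -> complete E' m.
Proof.
move=> e [mP mE Em]; split=> // [c x|x y]; first by rewrite -e; apply: mE.
by rewrite -e; apply: Em.
Qed.

Lemma complete_degree E m x : irreflexive E -> complete E m ->
  #|[set c | m c x != x]| = #|neighbours E x|.
Proof.
move=> Eirr mC; have [_ mE Em] := mC.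
have -> : neighbours E x = (fun c => m c x) @: [set c | m c x != x].
  apply/setP => y; rewrite inE; apply/idP/imsetP => [Exy|[c]].
    have [c mc] := Em _ _ Exy; exists c => //; rewrite inE mc.
    by apply: contraTneq Exy => ->; rewrite Eirr.
  by rewrite inE => /mE ? ->.
by rewrite card_in_imset // => c d; rewrite !inE => h _ e; apply: complete_proper mC e h.
Qed.

Lemma complete_all E m x : irreflexive E -> complete E m -> #|neighbours E x| = #|I| ->
  forall c, m c x != x.
Proof.
move=> Eirr mC d c; have : [set c | m c x != x] == setT.
  by rewrite eqEcard subsetT (complete_degree _ Eirr mC) d cardsT leqnn.
by move/eqP/setP/(_ c); rewrite !inE.
Qed.

Lemma complete_missing E m x : irreflexive E -> complete E m -> #|neighbours E x| < #|I| ->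
  exists c, m c x = x.
Proof.
move=> Eirr mC d; have [/existsP[c /eqP]|/existsPn none] := boolP [exists c, m c x == x].
  by exists c.
move: d; rewrite -(complete_degree _ Eirr mC) -cardsT.
by rewrite (_ : finset _ = setT) ?ltnn //; apply/setP => c; rewrite !inE none.
Qed.

Lemma complete_missing1 E m x c d : irreflexive E -> complete E m -> #|neighbours E x|.+1 = #|I| ->
  m c x = x -> (m d x == x) = (d == c).
Proof.
move=> Eirr mC; rewrite -(complete_degree _ Eirr mC) -(cardsC [set d | m d x == x]) => e mc.
have /cards1P[c' cE] : #|[set d | m d x == x]| == 1.
  have -> : #|[set d | m d x == x]| = #|[set c0 | m c0 x != x]|.+1 - #|~: [set d | m d x == x]|.
    by rewrite e addnK.
  have -> : ~: [set d | m d x == x] = [set c0 | m c0 x != x] by apply/setP => ?; rewrite !inE.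
  by rewrite subSnn.
have : c \in [set d | m d x == x] by rewrite inE mc.
rewrite cE inE => /eqP->.
by move/setP: cE => /(_ d); rewrite !inE.
Qed.

Lemma delete_sym E u v : symmetric E -> symmetric (delete E u v).
Proof. by move=> Esym x y; rewrite /delete /= Esym orbC ![(_ == u) && _]andbC ![(_ == v) && _]andbC. Qed.

Lemma delete_irr E u v : irreflexive E -> irreflexive (delete E u v).
Proof. by move=> Eirr x; rewrite /delete /= Eirr. Qed.

Lemma deleteC E u v x y : delete (delete E u v) x y =2 delete (delete E x y) u v.
Proof. by move=> z w; rewrite /delete /= -!andbA; congr (_ && _); rewrite andbC. Qed.

Lemma delete_swap E u v : delete E u v =2 delete E v u.
Proof. by move=> z w; rewrite /delete /= orbC. Qed.

Lemma neighbours_delete E u v : E u v -> neighbours (delete E u v) u = neighbours E u :\ v.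
Proof.
move=> Euv; apply/setP => w; rewrite !inE /delete /= eqxx /= andbC; congr (_ && _).
have [->|wv] //= := eqVneq w v; case: (eqVneq u v) => //= uv.
by rewrite uv (negPf wv).
Qed.

Lemma neighbours_delete_id E u v z : z != u -> z != v -> neighbours (delete E u v) z = neighbours E z.
Proof. by move=> zu zv; apply/setP => w; rewrite !inE /delete /= (negPf zu) (negPf zv) andbT. Qed.

Lemma degree_delete E u v : E u v -> #|neighbours (delete E u v) u|.+1 = #|neighbours E u|.
Proof. by move=> Euv; rewrite neighbours_delete // [RHS](cardsD1 v) inE Euv. Qed.

Lemma uncolour_complete E m c u v : complete E m -> m c u = v -> u != v ->
  complete (delete E u v) (uncolour m c u v).
Proof.
move=> mC muv uv; have [mP mE Em] := mC; have [mK mI] := mP.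
have mvu : m c v = u by rewrite -muv mK.
split=> [|d x|x y]; first exact: uncolour_proper.
  rewrite /uncolour; case: ifPn => [_|h mx]; first by rewrite eqxx.
  rewrite /delete /= mE //; apply: contra h.
  have key s t : s != t -> m c s = t -> (x == s) && (m d x == t) -> (d == c) && (x == s).
    move=> st ms /andP[/eqP xs /eqP mt]; rewrite xs eqxx andbT; apply/eqP.
    by apply: (complete_proper (x := s) mC); rewrite ?ms -?xs ?mt // xs eq_sym.
  case/orP=> [/(key _ _ uv muv)|/(key v u _ mvu)].
    by case/andP=> -> ->.
  by rewrite eq_sym => /(_ uv)/andP[-> ->]; rewrite orbT.
rewrite /delete /= => /andP[/Em[d mx] h]; exists d; rewrite /uncolour; case: ifP => // /andP[/eqP dc].
rewrite dc in mx; case/orP=> /eqP xE; case/negP: h.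
  by rewrite -mx xE muv !eqxx.
by rewrite -mx xE mvu !eqxx orbT.
Qed.

Lemma colour_complete E m c u v : symmetric E -> irreflexive E -> E u v -> complete (delete E u v) m ->
  m c u = u -> m c v = v -> complete E (colour m c u v).
Proof.
move=> Esym Eirr Euv mC mu mv; have [mP mE Em] := mC; have [mK mI] := mP.
have uv : u != v by apply: contraTneq Euv => ->; rewrite Eirr.
have none d : m d u != v.
  apply: contraTneq isT => mdu; have := mE d u; rewrite mdu eq_sym => /(_ uv).
  by rewrite /delete /= !eqxx andbF.
split=> [|d x|x y Exy]; first exact: colour_proper.
  have old : m d x != x -> E x (m d x) by move/mE=> /andP[].
  rewrite /colour; case: ifP => // _; case: (eqVneq x u) => [->//|_].
  by case: (eqVneq x v) => [->|//]; rewrite Esym.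
have [h|h] := boolP (((x == u) && (y == v)) || ((x == v) && (y == u))).
  exists c; rewrite /colour eqxx; case/orP: h => /andP[/eqP-> /eqP->]; rewrite eqxx //.
  by rewrite eq_sym (negPf uv).
have [d md] : exists d, m d x = y by apply: Em; rewrite /delete /= Exy.
exists d; rewrite /colour; case: (eqVneq d c) => [dc|//]; rewrite dc in md *.
case: (eqVneq x u) => [xu|_]; first by move: Exy; rewrite -md xu mu Eirr.
by case: (eqVneq x v) => [xv|//]; move: Exy; rewrite -md xv mv Eirr.
Qed.

Lemma describes_complete E n k el (V : nat -> T) (C : nat -> I) S m :
  describes n k el V C E S m -> all_coloured el S -> complete E m.
Proof.
case=> mP mE Em _ _ _ _ /allP col; split=> // x y /Em[//|[e [es ce _]]].
by have := col e; rewrite mem_iota es ce => /(_ isT).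
Qed.

Lemma opening_describes E (Vs : seq T) (Cs : seq I) v0 c0 el cols miss m :
  complete E m ->
  (forall e, e < size el -> nth 0 cols e < size Cs /\
     m (nth c0 Cs (nth 0 cols e)) (nth v0 Vs (src el e)) = nth v0 Vs (tgt el e)) ->
  (forall p i, p < size Vs -> i < size Cs ->
     (m (nth c0 Cs i) (nth v0 Vs p) == nth v0 Vs p) = (i \in nth [::] miss p)) ->
  (forall z, z \notin Vs -> (forall c, m c z != z) \/ (forall c, m c z = z)) ->
  describes (size Vs) (size Cs) el (nth v0 Vs) (nth c0 Cs) E (opening cols miss) m.
Proof.
move=> [mP mE Em] hcol hmis hout; split=> //= [x y /Em|z zV i j _ _].
  by left.
have /hout[] : z \notin Vs.
  by apply/negP => /(nthP v0)[p pn /eqP]; rewrite (negPf (zV _ pn)).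
  by move=> h; rewrite !(negPf (h _)).
by move=> h; rewrite !h.
Qed.

(** The hypothesis on vertices outside [Vs] provides [d_out] for any choice of the colours [Cs]. *)
Lemma play E (Vs : seq T) (Cs : seq I) v0 c0 el goal cols miss m s :
  symmetric E -> irreflexive E -> uniq Vs -> uniq Cs ->
  all (fun e : nat * nat => e.1 < e.2 < size Vs) el && uniq el ->
  complete E m ->
  (forall e, e < size el -> nth 0 cols e < size Cs /\
     m (nth c0 Cs (nth 0 cols e)) (nth v0 Vs (src el e)) = nth v0 Vs (tgt el e)) ->
  (forall p i, p < size Vs -> i < size Cs ->
     (m (nth c0 Cs i) (nth v0 Vs p) == nth v0 Vs p) = (i \in nth [::] miss p)) ->
  (forall z, z \notin Vs -> (forall c, m c z != z) \/ (forall c, m c z = z)) ->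
  check (size Vs) (size Cs) el goal (opening cols miss) s ->
  exists S' m', describes (size Vs) (size Cs) el (nth v0 Vs) (nth c0 Cs) E S' m' /\ goal S'.
Proof.
move=> Esym Eirr VsU CsU elP mC hcol hmis hout.
have d0 := opening_describes mC hcol hmis hout.
have Vinj p q : p < size Vs -> q < size Vs -> nth v0 Vs p = nth v0 Vs q -> p = q.
  by move=> ps qs /eqP; rewrite nth_uniq // => /eqP.
have Cinj i j : i < size Cs -> j < size Cs -> nth c0 Cs i = nth c0 Cs j -> i = j.
  by move=> ps qs /eqP; rewrite nth_uniq // => /eqP.
apply: check_sound d0 => // e es; have [_ me] := hcol e es.
have [_ mE _] := mC; rewrite -me mE // me.
have /andP[/allP elP' _] := elP; have /andP[h1 h2] := elP' _ (mem_nth (0, 0) es).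
rewrite nth_uniq //; last exact: ltn_trans h1 h2.
by rewrite eq_sym neq_ltn h1.
Qed.

End Families.

(** * The graph minus the new edge and one edge far from it *)

(* [F] is the split graph without the edges [v1 v2] and [x y]; [r_stuck] says
   that no full colouring of [F] leaves a colour for [v1 v2]. *)
Record residual (T I : finType) (F : rel T) (U : {set T}) (v1 v2 x y : T) : Prop := Residual {
  r_sym : symmetric F;
  r_irr : irreflexive F;
  r_uniq : uniq [:: v1; v2; x; y];
  r_in : {subset [:: v1; v2; x; y] <= U};
  r_deg : forall z, z \in U -> z \notin [:: v1; v2; x; y] -> #|neighbours F z| = #|I|;
  r_out : forall z w, F z w -> z \in U;
  r_x : #|neighbours F x|.+1 = #|I|;
  r_y : #|neighbours F y|.+1 = #|I|;
  r_v : #|neighbours F v1| + #|neighbours F v2| = #|I|;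
  r_v1 : 0 < #|neighbours F v1|;
  r_v2 : 0 < #|neighbours F v2|;
  r_disj : forall z, F v1 z -> F v2 z -> False;
  r_v12 : ~~ F v1 v2;
  r_xy : ~~ F x y;
  r_col : exists m c, [/\ @complete T I F m, m c x = x & m c y = y];
  r_stuck : forall m c, @complete T I F m -> m c v1 = v1 -> m c v2 = v2 -> False
}.

Lemma residual_swap_v (T I : finType) F (U : {set T}) v1 v2 x y :
  @residual T I F U v1 v2 x y -> @residual T I F U v2 v1 x y.
Proof.
case=> h1 h2 h3 h4 h5 h6 h7 h8 h9 h10 h11 h12 h13 h14 h15 h16.
have e z : (z \in [:: v2; v1; x; y]) = (z \in [:: v1; v2; x; y]) by rewrite !inE orbCA.
split=> //.
- by move: h3; rewrite /= !inE !negb_or eq_sym => /and4P[/and3P[-> -> ->] /andP[-> ->] ->].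
- by move=> z; rewrite e; apply: h4.
- by move=> z zU; rewrite e; apply: h5.
- by rewrite addnC.
- by move=> z a b; apply: h12 b a.
- by rewrite h1.
by move=> m c mC a b; apply: h16 mC b a.
Qed.

Lemma residual_swap_xy (T I : finType) F (U : {set T}) v1 v2 x y :
  @residual T I F U v1 v2 x y -> @residual T I F U v1 v2 y x.
Proof.
case=> h1 h2 h3 h4 h5 h6 h7 h8 h9 h10 h11 h12 h13 h14 h15 h16.
have e z : (z \in [:: v1; v2; y; x]) = (z \in [:: v1; v2; x; y]).
  by rewrite !inE; congr (_ || (_ || _)); rewrite orbC.
split=> //.
- move: h3; rewrite /= !inE !negb_or (eq_sym x).
  by case/and4P=> /and3P[-> -> ->] /andP[-> ->] ->.
- by move=> z; rewrite e; apply: h4.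
- by move=> z zU; rewrite e; apply: h5.
- by rewrite h1.
by case: h15 => m [c [mC mx my]]; exists m, c.
Qed.

(** * Overlaps forced by the degree bound *)

Section Counting.
Variables (n d w a b x y : nat).

(** The overlap is at least [3(d-1) - 2(n-4) = 3d - 2n + 5], hence at least 3. *)
Lemma three_overlap ab abx : w.+4 = n -> a.+1 = d -> b.+1 = d -> x.+1 = d ->
  a + b <= w + ab -> ab + x <= w + abx -> 2 * (n - 1) <= 3 * d -> 0 < abx.
Proof. lia. Qed.

(** The overlap is at least [4(d-1) - 3(n-4) = 4d + 8 - 3n]. *)
Lemma four_overlap ab xy abxy : w.+4 = n -> a.+1 = d -> b.+1 = d -> x.+1 = d -> y.+1 = d ->
  a + b <= w + ab -> x + y <= w + xy -> ab + xy <= w + abxy -> 3 * n < 4 * d + 8 -> 0 < abxy.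
Proof. lia. Qed.

(** The last two hypotheses give [8(n-1) <= 12d <= 9n - 24], so [n >= 16]. Then
    [uy >= 2d - n + 1 >= (n-1)/3 >= 5] exceeds the four exclusions. *)
Lemma remaining_overlap u uy uyz rest : w.+2 = n -> y.+1 = d -> u = d -> u + y <= w + uy ->
  uyz + rest = uy -> uyz <= 4 -> 4 * d + 8 <= 3 * n -> 2 * (n - 1) <= 3 * d -> 0 < rest.
Proof. lia. Qed.

Lemma pair_overlap o : w.+3 = n -> x.+1 = d -> d + x <= w + o -> 2 * (n - 1) <= 3 * d -> 0 < o.
Proof. lia. Qed.

Lemma second_degree e : 5 < n.+1 -> 1 + e = d -> 2 * (n - 1) <= 3 * d -> 1 < e.
Proof. lia. Qed.

End Counting.

(** * Kempe changes around [v1], [v2], [x] and [y] *)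

Section Residual.
Variables (T I : finType) (F : rel T) (U : {set T}) (v1 v2 x y : T).
Hypothesis R : @residual T I F U v1 v2 x y.

Let Fsym := r_sym R.
Let Firr := r_irr R.
Let stuck := r_stuck R.

Let v12 : v1 != v2. Proof. by move: (r_uniq R); rewrite /= !inE !negb_or => /andP[/and3P[]]. Qed.
Let v1x : v1 != x. Proof. by move: (r_uniq R); rewrite /= !inE !negb_or => /andP[/and3P[]]. Qed.
Let v1y : v1 != y. Proof. by move: (r_uniq R); rewrite /= !inE !negb_or => /andP[/and3P[]]. Qed.
Let v2x : v2 != x. Proof. by move: (r_uniq R); rewrite /= !inE !negb_or => /and3P[_ /andP[]]. Qed.
Let v2y : v2 != y. Proof. by move: (r_uniq R); rewrite /= !inE !negb_or => /and3P[_ /andP[]]. Qed.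
Let xy : x != y. Proof. by move: (r_uniq R); rewrite /= !inE !negb_or => /and4P[]. Qed.

(** By [r_stuck] the colours present at [v1] and those present at [v2] cover all colours; by [r_v]
    their numbers add up to [#|I|], so they form a partition. *)
Lemma missing_v (m : I -> T -> T) c : complete F m -> (m c v1 == v1) = (m c v2 != v2).
Proof.
move=> mC; pose A := [set c | m c v1 != v1]; pose B := [set c | m c v2 != v2].
have AB : A :|: B = setT.
  apply/setP => d; rewrite !inE; case: eqVneq => //= h1.
  by apply/eqP => h2; apply: (stuck mC h1 h2).
have : #|A :&: B| = 0.
  have := cardsUI A B; rewrite AB cardsT (complete_degree _ Firr mC).
  by rewrite (complete_degree _ Firr mC) (r_v R); lia.
move/eqP; rewrite cards_eq0 => /eqP/setP/(_ c); have /setP/(_ c) := AB.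
by rewrite !inE; case: (m c v1 == v1); case: (m c v2 == v2).
Qed.

Lemma stray (m : I -> T -> T) : complete F m -> forall z, z \notin [:: v1; v2; x; y] ->
  (forall c, m c z != z) \/ (forall c, m c z = z).
Proof.
move=> mC z zV; have [zU|zU] := boolP (z \in U).
  by left; apply: (complete_all Firr mC); apply: (r_deg R).
right=> c; apply/eqP; apply: contraNT zU => mz; have [_ mE _] := mC.
exact: (r_out R (mE _ _ mz)).
Qed.

(* If [v2] has the colour missing at [x] and [y], exchange it with one missing
   at [v2] on the chain joining [x] and [y]. *)
Lemma normalize : exists (m : I -> T -> T) c, [/\ complete F m, m c x = x, m c y = y & m c v2 = v2].
Proof.
have [m [c [mC mx my]]] := r_col R.
have [m2|m2] := eqVneq (m c v2) v2; first by exists m, c.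
have m1 : m c v1 == v1 by rewrite missing_v.
have [d md] : exists d, m d v2 = v2.
  apply: (complete_missing Firr mC); rewrite -(r_v R).
  by have := r_v1 R; lia.
have dc : d != c by apply: contra_eqN md => /eqP->.
have m1' : m d v1 != v1 by rewrite missing_v // md eqxx.
have mx1 e := complete_missing1 e Firr mC (r_x R) mx.
have my1 e := complete_missing1 e Firr mC (r_y R) my.
have hmis p i : p < 4 -> i < 2 -> (m (nth c [:: c; d] i) (nth x [:: v1; v2; x; y] p) ==
    nth x [:: v1; v2; x; y] p) = (i \in nth [::] [:: [:: 0]; [:: 1]; [:: 0]; [:: 0]] p).
  case: p => [|[|[|[|p]]]] // _; case: i => [|[|i]] // _;
    rewrite /= ?mx1 ?my1 ?(negPf m1') ?(negPf m2) ?m1 ?md //.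
  - by rewrite eqxx.
  - by rewrite eqxx.
  - by rewrite (negPf dc).
  - by rewrite eqxx.
  by rewrite (negPf dc).
have cdU : uniq [:: c; d] by rewrite /= inE eq_sym dc.
have [//|S' [m' [d' g]]] := play (el := [::]) (cols := [::]) Fsym Firr (r_uniq R) cdU isT mC _ hmis
  (stray mC) transfer_wins.
have m'C : complete F m' by apply: describes_complete d' _.
have mis := d_mis d'.
case/orP: g => /hasP[e]; rewrite mem_iota => /andP[_ e2].
  case/andP; rewrite -!mis //= => /eqP h1 /eqP h2.
  by case: (stuck m'C h1 h2).
case/and3P; rewrite -!mis //= => /eqP h2 /eqP hx /eqP hy.
by exists m', (nth c [:: c; d] e).
Qed.


(** Let [p] be the colour of [v2 x] and [c] a colour missing at both ends. Recolouring this edge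
    with [c] frees [p] at [v2], and [v1] misses [p] already. *)
Lemma not_adjacent_v2 : ~~ F v2 x.
Proof.
apply/negP => F2x; have [m [c [mC mx my m2]]] := normalize.
have [_ _ Em] := mC; have [p mp] := Em _ _ F2x.
have pc : p != c by apply: contraNneq v2x => pc; rewrite -mp pc m2.
have m1 : m p v1 == v1 by rewrite (missing_v _ mC) mp eq_sym.
have mC' := uncolour_complete mC mp v2x.
have hc z : m c z = z -> uncolour m p v2 x c z = z.
  by move=> mz; rewrite /uncolour eq_sym (negPf pc).
have mC2 := colour_complete Fsym Firr F2x mC' (hc _ m2) (hc _ mx).
apply: (stuck mC2 (c := p)); rewrite /colour (negPf pc) /uncolour eqxx /= ?eqxx //.
by rewrite (negPf v12) (negPf v1x); apply/eqP.
Qed.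

(** If [v1] had two neighbours, Kempe changes along [v1 v2 u x] would make [v1] and [v2] miss a
    common colour. *)
Lemma kierstead_path u : F v2 u -> F x u -> #|neighbours F v1| <= 1.
Proof.
move=> F2u Fxu; rewrite leqNgt; apply/negP => N1.
have [m [c [mC mx my m2]]] := normalize.
have [mP mE Em] := mC; have [mK mI] := mP.
have [p mp] := Em _ _ F2u; have [q mq] := Em _ _ Fxu.
have ux : u != x by apply: contraTneq Fxu => ->; rewrite Firr.
have u2 : u != v2 by apply: contraTneq F2u => ->; rewrite Firr.
have uV : u \notin [:: v1; v2; x; y].
  rewrite !inE !negb_or ux u2 /= andbC.
  apply/andP; split; first by apply: contraTneq Fxu => ->; apply: r_xy R.
  by apply: contraTneq F2u => ->; rewrite Fsym; apply: r_v12 R.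
have mu e : (m e u == u) = false.
  apply/negbTE; apply: (complete_all Firr mC); apply: (r_deg R _ uV).
  by apply: (r_out R (w := x)); rewrite Fsym.
have mx1 e := complete_missing1 e Firr mC (r_x R) mx.
have my1 e := complete_missing1 e Firr mC (r_y R) my.
have m1 e := missing_v e mC.
have pc : p != c by apply: contraNneq u2 => pc; rewrite -mp pc m2.
have qc : q != c by apply: contraNneq ux => qc; rewrite -mq qc mx.
have pq : p != q.
  by apply: contraNneq v2x => pq; apply/eqP; rewrite -(mK p v2) mp pq -mq mK.
have mp2 : (m p v2 == v2) = false by rewrite mp; apply/negbTE.
have VU : uniq [:: v1; v2; x; y; u].
  by rewrite -[[:: _; _; _; _; _]]/(rcons [:: v1; v2; x; y] u) rcons_uniq uV (r_uniq R).
have out z : z \notin [:: v1; v2; x; y; u] -> (forall c, m c z != z) \/ (forall c, m c z = z).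
  by move=> zV; apply: stray => //; apply: contra zV; rewrite !inE => /or4P[]->; rewrite ?orbT.
have fin k Cs S' m' : describes 5 k [:: (1, 4); (2, 4)] (nth x [:: v1; v2; x; y; u]) (nth c Cs) F S' m' ->
    shared k [:: (1, 4); (2, 4)] S' -> False.
  move=> d' /andP[col /hasP[e]]; rewrite mem_iota => /andP[_ ek] /andP[].
  have m'C := describes_complete d' col.
  by rewrite -!(d_mis d') // => /eqP h1 /eqP h2; apply: (stuck m'C h1 h2).
(* By [missing_v] the colour [q] of [x u] is missing at exactly one of [v2] and [v1]; each case has
   its own strategy. *)
have [mq2|mq2] := boolP (m q v2 == v2).
  have CU : uniq [:: p; q; c] by rewrite /= !inE !negb_or pq pc qc.
  have [||S' [m' [d' g]]] := play (v0 := x) (c0 := c) (el := [:: (1, 4); (2, 4)])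
    Fsym Firr VU CU isT mC _ _ out path_here_wins => //.
  - by case=> [|[|e]].
  - by case=> [|[|[|[|[|e]]]]] // [|[|[|i]]] // _ _;
      rewrite /= ?m1 ?mx1 ?my1 ?mu ?mp2 ?mq2 ?m2 ?eqxx ?inE ?(negPf pc) ?(negPf qc).
  exact: (fin 3 _ _ _ d' g).
(* The colours missing at [v2] are those present at [v1], so the degree of [v1] yields one besides
   [c]. *)
have [d md dc] : exists2 d, m d v2 = v2 & d != c.
  have cS : c \in [set d | m d v2 == v2] by rewrite inE m2.
  have : 1 < #|[set d | m d v2 == v2]|.
    have := cardsC [set d | m d v2 != v2]; rewrite (complete_degree _ Firr mC) -(r_v R) addnC.
    move/addIn => e; move: N1; rewrite -e; congr (_ < _); apply: eq_card => d.
    by rewrite !inE negbK.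
  rewrite (cardsD1 c) cS ltnS => /card_gt0P[d]; rewrite !inE => /andP[dc /eqP md].
  by exists d.
have pd : p != d by apply: contraNneq u2 => pd; rewrite -mp pd md.
have qd : q != d by apply: contraNneq mq2 => ->; rewrite md.
have CU : uniq [:: p; q; c; d] by rewrite /= !inE !negb_or pq pc qc pd qd eq_sym dc.
have [||S' [m' [d' g]]] := play (v0 := x) (c0 := c) (el := [:: (1, 4); (2, 4)])
    Fsym Firr VU CU isT mC _ _ out path_there_wins => //.
- by case=> [|[|e]].
- by case=> [|[|[|[|[|e]]]]] // [|[|[|[|i]]]] // _ _;
    rewrite /= ?m1 ?mx1 ?my1 ?mu ?mp2 ?(negPf mq2) ?m2 ?md ?eqxx ?inE
      ?(negPf pc) ?(negPf qc) ?(negPf dc).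
exact: (fin 4 _ _ _ d' g).
Qed.


(** * The case of a single neighbour: kites and brooms *)

Section SingleNeighbour.
Variable a : T.
Hypotheses (F1a : F v1 a) (N1 : #|neighbours F v1| = 1).
Hypotheses (ax : a != x) (ay : a != y).
Hypotheses (nax : ~~ F a x) (nay : ~~ F a y) (n2x : ~~ F v2 x) (n2y : ~~ F v2 y).

Let F' := delete F v1 a.

Let F'sym : symmetric F'. Proof. exact: delete_sym. Qed.
Let F'irr : irreflexive F'. Proof. exact: delete_irr. Qed.

Let v1a : v1 != a. Proof. by apply: contraTneq F1a => ->; rewrite Firr. Qed.
Let av2 : a != v2. Proof. by apply: contraTneq F1a => ->; apply: r_v12 R. Qed.

Let aV : a \notin [:: v1; v2; x; y].
Proof. by rewrite !inE !negb_or eq_sym v1a av2 ax ay. Qed.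

Let aU : a \in U. Proof. by apply: (r_out R (w := v1)); rewrite Fsym. Qed.

Lemma isolated_v1 : neighbours F' v1 = set0.
Proof.
have /cards1P[b bE] : #|neighbours F v1| == 1 by rewrite N1.
rewrite neighbours_delete // bE; have : a \in neighbours F v1 by rewrite inE.
by rewrite bE inE => /eqP->; rewrite setDv.
Qed.

(** Deleting [v1 a] puts [a] on a par with [v2], [x] and [y]: each now misses exactly one colour. *)
Lemma degree_pruned z : z \in [:: a; v2; x; y] -> #|neighbours F' z|.+1 = #|I|.
Proof.
rewrite !inE => /or4P[]/eqP->.
- have <- : #|neighbours (delete F a v1) a|.+1 = #|I|.
    by rewrite degree_delete 1?Fsym // (r_deg R aU aV).
  congr (_.+1); by apply: eq_card => w; rewrite !inE /F' delete_swap.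
- have := r_v R; rewrite N1 add1n => <-.
  by rewrite neighbours_delete_id // eq_sym.
- by rewrite neighbours_delete_id ?(r_x R) // eq_sym.
by rewrite neighbours_delete_id ?(r_y R) // eq_sym.
Qed.

Lemma stray_pruned (m : I -> T -> T) : complete F' m -> forall z, z \notin [:: a; v2; x; y] ->
  (forall c, m c z != z) \/ (forall c, m c z = z).
Proof.
move=> mC z; rewrite !inE !negb_or => /and4P[za z2 zx zy].
have [zv1|zv1] := eqVneq z v1.
  right=> c; apply/eqP; apply: contraT => mz; have [_ mE _] := mC.
  by have := mE _ _ mz; rewrite zv1 => h; have := in_set0 (m c v1); rewrite -isolated_v1 inE -{1}zv1 zv1 h.
have [zU|zU] := boolP (z \in U).
  left; apply: (complete_all F'irr mC); rewrite neighbours_delete_id //.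
  by apply: (r_deg R zU); rewrite !inE !negb_or zv1 z2 zx zy.
right=> c; apply/eqP; apply: contraNT zU => mz; have [_ mE _] := mC.
by have /andP[/(r_out R)] := mE _ _ mz.
Qed.

(** Give [i] to [v1 a]. It is then the only colour at [v1], and the colour [j] missing at [v2]
    differs from it, so [j] is free at both ends of [v1 v2]. *)
Lemma different_missing (m : I -> T -> T) i : complete F' m -> m i a = a -> m i v2 != v2 -> False.
Proof.
move=> mC mia mi2.
have [j mj] : exists j, m j v2 = v2.
  by apply: (complete_missing F'irr mC); rewrite -(degree_pruned (z := v2)) // !inE eqxx orbT.
have ji : j != i by apply: contraNneq mi2 => <-; rewrite mj.
have m1 d : m d v1 = v1.
  apply/eqP; apply: contraT => mz; have [_ mE _] := mC.
  by have := in_set0 (m d v1); rewrite -isolated_v1 inE mE.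
have mC' := colour_complete Fsym Firr F1a mC (m1 i) mia.
by apply: (stuck mC' (c := j)); rewrite /colour (negPf ji).
Qed.

(** In a normalized colouring [v2] misses [c], so [v1] sees it, necessarily on [v1 a]. Uncolouring
    this edge frees [c] at [a]. *)
Lemma pruned_colouring : exists (m : I -> T -> T) c,
  [/\ complete F' m, m c a = a, m c v2 = v2, m c x = x & m c y = y].
Proof.
have [m [c [mC mx my m2]]] := normalize.
have m1 : m c v1 != v1 by have := missing_v c mC; rewrite m2 eqxx => ->.
have mca : m c v1 = a.
  have [_ mE _] := mC; have : m c v1 \in neighbours F v1 by rewrite inE mE.
  have /cards1P[b bE] : #|neighbours F v1| == 1 by rewrite N1.
  have : a \in neighbours F v1 by rewrite inE.
  by rewrite bE !inE => /eqP<- /eqP.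
exists (uncolour m c v1 a), c; split; first exact: uncolour_complete.
- by rewrite /uncolour !eqxx orbT.
- by rewrite /uncolour; case: ifP.
- by rewrite /uncolour; case: ifP.
by rewrite /uncolour; case: ifP.
Qed.

Section Configuration.
Variables (m : I -> T -> T) (c : I).
Hypotheses (mC : complete F' m) (ma : m c a = a) (m2 : m c v2 = v2) (mx : m c x = x) (my : m c y = y).

Let Vs := [:: a; v2; x; y].

Let VsU : uniq Vs.
Proof.
move: (r_uniq R); rewrite /= !inE !negb_or av2 ax ay /=.
by case/and4P=> _ -> -> _.
Qed.

Let missing z e : z \in Vs -> (m e z == z) = (e == c).
Proof.
move=> zV; apply: (complete_missing1 _ F'irr mC (degree_pruned zV)).
by move: zV; rewrite !inE => /or4P[]/eqP->.
Qed.

Let full z w e : F' z w -> z \notin Vs -> (m e z == z) = false.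
Proof.
move=> zw zV; have [h|h] := stray_pruned mC zV; first exact/negbTE.
have [_ _ Em] := mC; have [d md] := Em _ _ zw.
by move: zw; rewrite -md h F'irr.
Qed.

Let finish n k el (V : nat -> T) (C : nat -> I) S' m' : V 0 = a -> V 1 = v2 -> 1 < n ->
  describes n k el V C F' S' m' -> different k el S' -> False.
Proof.
move=> Va V2 n1 d' /andP[col /hasP[e]]; rewrite mem_iota => /andP[_ ek] /andP[].
have m'C := describes_complete d' col.
rewrite -!(d_mis d') // ?Va ?V2; last exact: ltnW.
by move=> /eqP h1 h2; apply: (different_missing m'C h1 h2).
Qed.

Lemma no_kite u : F' a u -> F' v2 u -> F' x u -> F' y u -> False.
Proof.
move=> Fa F2 Fx Fy; have [_ _ Em] := mC.
have [c1 m1] := Em _ _ Fa; have [c2 m2'] := Em _ _ F2.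
have [c3 m3] := Em _ _ Fx; have [c4 m4] := Em _ _ Fy.
have uz z : F' z u -> u != z by move=> h; apply: contraTneq h => ->; rewrite F'irr.
have uV : u \notin Vs by rewrite !inE !negb_or !uz.
have VU : uniq [:: a; v2; x; y; u].
  by rewrite -[[:: _; _; _; _; _]]/(rcons Vs u) rcons_uniq uV VsU.
have nc d z : m d z = u -> z \in Vs -> c != d.
  by move=> mz zV; rewrite eq_sym -(missing d zV) mz; apply: contra uV => /eqP->.
have dd d e z w : m d z = u -> m e w = u -> z != w -> d != e.
  by move=> mz mw; apply: contraNneq => de; apply/eqP;
    rewrite -(completeK d mC z) mz de -mw (completeK _ mC).
have CU : uniq [:: c; c1; c2; c3; c4].
  move: VsU; rewrite /= !inE !negb_or !andbT.
  case/and3P=> /and3P[h1 h2 h3] /andP[h4 h5] h6.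
  rewrite (nc _ _ m1) ?(nc _ _ m2') ?(nc _ _ m3) ?(nc _ _ m4) ?inE ?eqxx ?orbT //=.
  by rewrite (dd _ _ _ _ m1 m2') ?(dd _ _ _ _ m1 m3) ?(dd _ _ _ _ m1 m4) ?(dd _ _ _ _ m2' m3)
    ?(dd _ _ _ _ m2' m4) ?(dd _ _ _ _ m3 m4).
have out z : z \notin [:: a; v2; x; y; u] -> (forall c, m c z != z) \/ (forall c, m c z = z).
  move=> zV; apply: stray_pruned => //; apply: contra zV.
  by rewrite !inE => /or4P[]->; rewrite ?orbT.
have mu e : (m e u == u) = false by apply: (full (w := a)); rewrite 1?F'sym.
have [||S' [m' [d' g]]] := play (v0 := x) (c0 := c) (el := [:: (0, 4); (1, 4); (2, 4); (3, 4)])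
    F'sym F'irr VU CU isT mC _ _ out kite_wins => //.
- by case=> [|[|[|[|e]]]].
- move=> p i p5 i5; rewrite [RHS](_ : _ = (p < 4) && (i == 0)); last first.
    by case: p p5 => [|[|[|[|[|p]]]]] // _; case: i i5 => [|[|[|[|[|i]]]]].
  have [p4|] := ltnP p 4; last first.
    by case: p p5 => [|[|[|[|[|p]]]]].
  rewrite (_ : nth x _ p = nth x Vs p); last by case: p p4 {p5} => [|[|[|[|p]]]].
  by rewrite missing ?mem_nth // -[RHS](nth_uniq c i5 _ CU).
by apply: (finish _ _ _ d' g).
Qed.


(** The strategy needs six distinct colours. Those at [u] differ from each other, [c4] and [c5] meet
    at [w], and [c] is missing at the four leaves; the last two hypotheses exclude the remaining
    coincidences. *)
Lemma no_broom u w c1 c2 c3 c4 c5 : w \notin Vs ->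
  m c1 a = u -> m c2 v2 = u -> m c3 x = u -> m c4 u = w -> m c5 y = w ->
  F' a u -> F' v2 u -> F' x u -> F' u w -> F' y w -> u != y ->
  c4 != c -> c5 \notin [:: c1; c2; c3] -> False.
Proof.
move=> wV m1 m2' m3 m4 m5 Fa F2 Fx Fuw Fyw uy c4c c5C.
have uz z : F' z u -> u != z by move=> h; apply: contraTneq h => ->; rewrite F'irr.
have uV : u \notin Vs by rewrite !inE !negb_or uy !uz.
have wu : w != u by apply: contraTneq Fuw => ->; rewrite F'irr.
have VU : uniq [:: a; v2; x; y; u; w].
  rewrite -[[:: _; _; _; _; _; _]]/(Vs ++ [:: u; w]) cat_uniq VsU /= !orbF.
  by rewrite negb_or uV wV inE eq_sym wu.
have nc d z t : t \notin Vs -> m d z = t -> z \in Vs -> c != d.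
  by move=> tV mz zV; rewrite eq_sym -(missing d zV) mz; apply: contra tV => /eqP->.
have dd d e z z' t : m d z = t -> m e z' = t -> z != z' -> d != e.
  by move=> mz mw; apply: contraNneq => de; apply/eqP;
    rewrite -(completeK d mC z) mz de -mw (completeK _ mC).
have m4' : m c4 w = u by rewrite -m4 (completeK _ mC).
have m45 : c4 != c5.
  by apply: contraNneq uy => e; rewrite -m4' e -m5 (completeK _ mC).
have CU : uniq [:: c; c1; c2; c3; c4; c5].
  move: VsU c5C; rewrite /= !inE !negb_or !andbT => VsU'.
  case/and3P: (VsU') => /and3P[h1 h2 h3] /andP[h4 h5] h6 /and3P[k1 k2 k3].
  rewrite (nc _ _ _ uV m1) ?(nc _ _ _ uV m2') ?(nc _ _ _ uV m3) ?(nc _ _ _ wV m5) ?inE ?eqxx ?orbT //=.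
  rewrite eq_sym c4c /= m45 andbT ![_ == c5]eq_sym k1 k2 k3 !andbT.
  have [aw v2w xw] : [/\ a != w, v2 != w & x != w].
    by split; apply: contraNneq wV => <-; rewrite !inE eqxx ?orbT.
  rewrite (dd _ _ _ _ _ m1 m2' h1) (dd _ _ _ _ _ m1 m3 h2) (dd _ _ _ _ _ m2' m3 h4).
  by rewrite (dd _ _ _ _ _ m1 m4' aw) (dd _ _ _ _ _ m2' m4' v2w) (dd _ _ _ _ _ m3 m4' xw).
have out z : z \notin [:: a; v2; x; y; u; w] -> (forall c, m c z != z) \/ (forall c, m c z = z).
  move=> zV; apply: stray_pruned => //; apply: contra zV.
  by rewrite !inE => /or4P[]->; rewrite ?orbT.
have mu e : (m e u == u) = false by apply: (full (w := a)); rewrite 1?F'sym.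
have mw e : (m e w == w) = false by apply: (full (w := u)); rewrite 1?F'sym.
have [||S' [m' [d' g]]] := play (v0 := x) (c0 := c)
    (el := [:: (0, 4); (1, 4); (2, 4); (4, 5); (3, 5)])
    F'sym F'irr VU CU isT mC _ _ out broom_wins => //.
- by case=> [|[|[|[|[|e]]]]].
- move=> p i p5 i5; rewrite [RHS](_ : _ = (p < 4) && (i == 0)); last first.
    by case: p p5 => [|[|[|[|[|[|p]]]]]] // _; case: i i5 => [|[|[|[|[|[|i]]]]]].
  have [p4|] := ltnP p 4; last first.
    by case: p p5 => [|[|[|[|[|[|p]]]]]].
  rewrite (_ : nth x _ p = nth x Vs p); last by case: p p4 {p5} => [|[|[|[|p]]]].
  by rewrite missing ?mem_nth // -[RHS](nth_uniq c i5 _ CU).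
by apply: (finish _ _ _ d' g).
Qed.

End Configuration.


(** [a], [v2], [x] and [y] are pairwise nonadjacent, so their neighbourhoods lie in the [n-4]
    vertices of [W] and counting forces a kite or a broom. *)
Lemma single_neighbour_dense n : #|U| = n.+1 -> 2 * (n - 1) <= 3 * #|I| -> False.
Proof.
move=> cU dense; have [m [c [mC ma m2 mx my]]] := pruned_colouring.
pose A := neighbours F' a; pose B := neighbours F' v2.
pose X := neighbours F' x; pose Y := neighbours F' y.
pose W := U :\ v1 :\ v2 :\ a :\ x :\ y.
have [v1U v2U xU yU] : [/\ v1 \in U, v2 \in U, x \in U & y \in U].
  by split; apply: (r_in R); rewrite !inE eqxx ?orbT.
have [v21 av1 xv1 yv1] : [/\ v2 != v1, a != v1, x != v1 & y != v1] by split; rewrite eq_sym.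
have [xv2 yv2 yx] : [/\ x != v2, y != v2 & y != x] by split; rewrite eq_sym.
have [xa ya] : x != a /\ y != a by split; rewrite eq_sym.
have cW : #|W|.+4 = n.
  apply/eqP; rewrite -eqSS -cU (cardsD1 v1 U) v1U (cardsD1 v2 (U :\ v1)) !inE v2U v21 /=.
  rewrite (cardsD1 a (U :\ v1 :\ v2)) !inE aU av2 av1 /=.
  rewrite (cardsD1 x (U :\ v1 :\ v2 :\ a)) !inE xU xa xv2 xv1 /=.
  by rewrite (cardsD1 y (U :\ v1 :\ v2 :\ a :\ x)) !inE yU yx ya yv2 yv1.
have F'F z w : F' z w -> F z w by case/andP.
have iso w : F' v1 w = false by have := in_set0 w; rewrite -isolated_v1 inE.
have indep z w : z \in [:: a; v2; x; y] -> w \in [:: a; v2; x; y] -> ~~ F z w.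
  have na2 : ~~ F a v2 by apply/negP => h; apply: (r_disj R F1a); rewrite Fsym.
  have nxy := r_xy R.
  by rewrite !inE => /or4P[]/eqP-> /or4P[]/eqP->;
    rewrite ?Firr ?na2 ?nax ?nay ?n2x ?n2y ?nxy // Fsym ?na2 ?nax ?nay ?n2x ?n2y ?nxy.
have outside z w : z \in [:: a; v2; x; y] -> F' z w -> w \notin [:: a; v2; x; y].
  by move=> zV zw; apply/negP => wV; case/negP: (indep _ _ zV wV); apply: F'F.
have sub z : z \in [:: a; v2; x; y] -> neighbours F' z \subset W.
  move=> zV; apply/subsetP => w; rewrite !inE => zw.
  have wU : w \in U by apply: (r_out R (w := z)); rewrite Fsym; apply: F'F.
  have wv1 : w != v1 by apply: contraTneq zw => ->; rewrite F'sym iso.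
  have := outside _ _ zV zw; rewrite !inE !negb_or wU wv1.
  by case/and4P=> -> -> -> ->.
have cA : #|A|.+1 = #|I| by apply: degree_pruned; rewrite !inE eqxx ?orbT.
have cB : #|B|.+1 = #|I| by apply: degree_pruned; rewrite !inE eqxx ?orbT.
have cX : #|X|.+1 = #|I| by apply: degree_pruned; rewrite !inE eqxx ?orbT.
have cY : #|Y|.+1 = #|I| by apply: degree_pruned; rewrite !inE eqxx ?orbT.
have sA : A \subset W by apply: sub; rewrite !inE eqxx ?orbT.
have sB : B \subset W by apply: sub; rewrite !inE eqxx ?orbT.
have sX : X \subset W by apply: sub; rewrite !inE eqxx ?orbT.
have sY : Y \subset W by apply: sub; rewrite !inE eqxx ?orbT.
have inter (P Q : {set T}) : P \subset W -> Q \subset W -> #|P| + #|Q| <= #|W| + #|P :&: Q|.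
  move=> sP sQ; rewrite -cardsUI leq_add2r; apply: subset_leq_card.
  by rewrite subUset sP.
have sAB : A :&: B \subset W by apply: subset_trans sA; apply: subsetIl.
have sXY : X :&: Y \subset W by apply: subset_trans sX; apply: subsetIl.
have cAB := inter _ _ sA sB; have cXY := inter _ _ sX sY.
have cABX := inter _ _ sAB sX; have cABXY := inter _ _ sAB sXY.
have [u] : exists u, u \in A :&: B :&: X.
  exact/card_gt0P/(three_overlap cW cA cB cX cAB cABX dense).
rewrite !inE => /andP[/andP[Fau F2u] Fxu].
have n16 : 4 * #|I| + 8 <= 3 * n.
  rewrite leqNgt; apply/negP => h.
  have [z] : exists z, z \in A :&: B :&: (X :&: Y).
    exact/card_gt0P/(four_overlap cW cA cB cX cY cAB cXY cABXY h).
  by rewrite !inE => /andP[/andP[Fa F2] /andP[Fx Fy]]; apply: (no_kite mC ma m2 mx my Fa F2 Fx Fy).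
have nyu : ~~ F' y u by apply/negP => Fyu; apply: (no_kite mC ma m2 mx my Fau F2u Fxu Fyu).
have uW : u \in W by apply: (subsetP sA); rewrite inE.
move: uW; rewrite !inE => /and5P[uy ux ua u2 /andP[uv1 uU]].
(* Since [u] and [y] are not adjacent, both neighbourhoods avoid [u] and [y] as well as the isolated
   [v1]. *)
pose W' := U :\ v1 :\ u :\ y.
have cW' : #|W'|.+2 = n.
  apply/eqP; rewrite -eqSS -cU (cardsD1 v1 U) v1U (cardsD1 u (U :\ v1)) !inE uU uv1 /=.
  by rewrite (cardsD1 y (U :\ v1 :\ u)) !inE yU (eq_sym y u) uy yv1.
have sub' z : z \in U -> z != v1 -> F' z u = false -> F' z y = false -> neighbours F' z \subset W'.
  move=> zU zv1 zu zy; apply/subsetP => w; rewrite !inE => zw.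
  have wU : w \in U by apply: (r_out R (w := z)); rewrite Fsym; apply: F'F.
  rewrite wU andbT; apply/and3P; split; apply: contraTneq zw => ->.
  - by rewrite zy.
  - by rewrite zu.
  by rewrite F'sym iso.
have sY' : Y \subset W' by apply: sub'; rewrite ?(negbTE nyu) ?F'irr // eq_sym.
have sN : neighbours F' u \subset W' by apply: sub'; rewrite ?F'irr // F'sym (negbTE nyu).
have cN : #|neighbours F' u| = #|I|.
  rewrite neighbours_delete_id //; apply: (r_deg R uU).
  by rewrite !inE !negb_or uv1 u2 ux uy.
have cNY : #|neighbours F' u| + #|Y| <= #|W'| + #|neighbours F' u :&: Y|.
  by rewrite -cardsUI leq_add2r subset_leq_card // subUset sN.
have [_ _ Em] := mC.
have [c1 m1] := Em _ _ Fau; have [c2 m2'] := Em _ _ F2u; have [c3 m3] := Em _ _ Fxu.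
(* The four bad choices of [w]: colour [c] on [u w], or one of [c1], [c2], [c3] on [y w]. *)
pose Z := [set z in [:: m c u; m c1 y; m c2 y; m c3 y]].
have cZ : #|Z| <= 4.
  by rewrite cardsE (leq_trans (card_size _)).
have [w] : exists w, w \in (neighbours F' u :&: Y) :\: Z.
  apply/card_gt0P; have cI := cardsID Z (neighbours F' u :&: Y).
  have cZ' := leq_trans (subset_leq_card (subsetIr (neighbours F' u :&: Y) Z)) cZ.
  exact: (remaining_overlap cW' cY cN cNY cI cZ' n16 dense).
rewrite !inE !negb_or => /andP[/and4P[w0 w1 w2 w3] /andP[Fuw Fyw]].
have [c4 m4] := Em _ _ Fuw; have [c5 m5] := Em _ _ Fyw.
apply: (no_broom mC ma m2 mx my (outside _ _ _ Fyw) m1 m2' m3 m4 m5) => //.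
- by rewrite !inE eqxx !orbT.
- by apply: contraNneq w0 => <-; rewrite m4.
by rewrite !inE !negb_or; apply/and3P; split;
  [apply: contraNneq w1 | apply: contraNneq w2 | apply: contraNneq w3] => <-; rewrite m5.
Qed.


End SingleNeighbour.

End Residual.

Lemma residual_single (T I : finType) F (U : {set T}) v1 v2 x y n : @residual T I F U v1 v2 x y ->
  #|U| = n.+1 -> 2 * (n - 1) <= 3 * #|I| -> #|neighbours F v1| = 1 -> False.
Proof.
move=> R cU dense N1.
have nv2x := not_adjacent_v2 R; have nv2y := not_adjacent_v2 (residual_swap_xy R).
have nv1x := not_adjacent_v2 (residual_swap_v R).
have nv1y := not_adjacent_v2 (residual_swap_xy (residual_swap_v R)).
have Fsym := r_sym R; have Firr := r_irr R.
have [a] : exists a, a \in neighbours F v1 by apply/card_gt0P; rewrite N1.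
rewrite inE => F1a.
have [b] : exists b, b \in neighbours F v2 by apply/card_gt0P/(r_v2 R).
rewrite inE => F2b.
have ax : a != x by apply: contraNneq nv1x => <-.
have ay : a != y by apply: contraNneq nv1y => <-.
have bx : b != x by apply: contraNneq nv2x => <-.
have bNy : b != y by apply: contraNneq nv2y => <-.
have av1 : a != v1 by apply: contraTneq F1a => ->; rewrite Firr.
have bv2 : b != v2 by apply: contraTneq F2b => ->; rewrite Firr.
have av2 : a != v2 by apply: contraTneq F1a => ->; apply: r_v12 R.
have bv1 : b != v1 by apply: contraTneq F2b => ->; rewrite Fsym; apply: r_v12 R.
have ba : b != a by apply: contraTneq F2b => ->; apply/negP => F2a; apply: (r_disj R F1a F2a).
have VU : uniq [:: b, a & [:: v1; v2; x; y]].
  by rewrite cons_uniq cons_uniq (r_uniq R) !inE !negb_or ax ay bx bNy av1 av2 bv1 bv2 ba.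
have /(uniq_leq_size VU) : {subset [:: b, a & [:: v1; v2; x; y]] <= enum U}.
  move=> z; rewrite mem_enum in_cons in_cons => /or3P[/eqP->|/eqP->|/(r_in R)//].
    by apply: (r_out R (w := v2)); rewrite Fsym.
  by apply: (r_out R (w := v1)); rewrite Fsym.
rewrite -cardE cU /= => n6.
(* Six distinct vertices give [n >= 5], so there are at least three colours and [v2] keeps two
   neighbours. *)
have N2 : 1 < #|neighbours F v2|.
  by have := r_v R; rewrite N1 => NI; apply: (second_degree n6 NI dense).
apply: (single_neighbour_dense R F1a N1 ax ay _ _ nv2x nv2y cU dense).
  (* An edge [a x] would make [v2 v1 a x] a Kierstead path with the ends of [v1 v2] in reverse
     roles, leaving [v2] at most one neighbour. *)
  by apply/negP; rewrite Fsym => Fxa; have := kierstead_path (residual_swap_v R) F1a Fxa; rewrite leqNgt N2.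
apply/negP; rewrite Fsym => Fya.
by have := kierstead_path (residual_swap_xy (residual_swap_v R)) F1a Fya; rewrite leqNgt N2.
Qed.

(** The neighbours of [v1] and [v2] number [D], those of [x] number [D-1], all among [n-3] vertices.
    A common one [u] completes a Kierstead path, so the other end of [v1 v2] has a single
    neighbour. *)
Lemma residual_dense (T I : finType) F (U : {set T}) v1 v2 x y n :
  #|U| = n.+1 -> 2 * (n - 1) <= 3 * #|I| -> ~ @residual T I F U v1 v2 x y.
Proof.
move=> cU dense R.
have nv2x := not_adjacent_v2 R; have nv2y := not_adjacent_v2 (residual_swap_xy R).
have nv1x := not_adjacent_v2 (residual_swap_v R).
have nv1y := not_adjacent_v2 (residual_swap_xy (residual_swap_v R)).
have Fsym := r_sym R; have Firr := r_irr R.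
pose W := U :\: [set z in [:: v1; v2; x; y]].
have cW : #|W|.+3 = n.
  have := cardsID [set z in [:: v1; v2; x; y]] U; rewrite (setIidPr _); last first.
    by apply/subsetP => z; rewrite inE => /(r_in R).
  by rewrite cardsE (card_uniqP (r_uniq R)) cU -/W => -[].
have sub z : (forall t, t \in [:: v1; v2; x; y] -> ~~ F z t) -> neighbours F z \subset W.
  move=> none; apply/subsetP => t; rewrite !inE => zt.
  have -> : t \in U by apply: (r_out R (w := z)); rewrite Fsym.
  rewrite andbT; apply/negP => tV; have := none t; rewrite !inE tV zt.
  by move/(_ isT).
have none z t : z \in [:: v1; v2; x] -> t \in [:: v1; v2; x; y] -> ~~ F z t.
  have := r_v12 R; have := r_xy R.
  by rewrite !inE => nxy n12 /or3P[]/eqP-> /or4P[]/eqP->; rewrite ?Firr // Fsym.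
have disj : #|neighbours F v1 :|: neighbours F v2| = #|I|.
  rewrite cardsU (r_v R) (_ : _ :&: _ = set0) ?cards0 ?subn0 //.
  by apply/setP => z; rewrite !inE; apply/negP => /andP[/(r_disj R) h /h].
have sN : neighbours F v1 :|: neighbours F v2 \subset W.
  by rewrite subUset !sub // => t; apply: none; rewrite !inE eqxx ?orbT.
have sX : neighbours F x \subset W by apply: sub => t; apply: none; rewrite !inE eqxx ?orbT.
have : #|neighbours F v1 :|: neighbours F v2| + #|neighbours F x| <=
    #|W| + #|(neighbours F v1 :|: neighbours F v2) :&: neighbours F x|.
  by rewrite -cardsUI leq_add2r subset_leq_card // subUset sN.
rewrite disj => h.
have [u] : exists u, u \in (neighbours F v1 :|: neighbours F v2) :&: neighbours F x.
  exact/card_gt0P/(pair_overlap cW (r_x R) h dense).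
rewrite !inE => /andP[/orP[F1u|F2u] Fxu].
  have := kierstead_path (residual_swap_v R) F1u Fxu; have := r_v2 R => N2 N2'.
  by apply: (residual_single (residual_swap_v R) cU dense); apply/eqP; rewrite eqn_leq N2'.
have := kierstead_path R F2u Fxu; have := r_v1 R => N1 N1'.
by apply: (residual_single R cU dense); apply/eqP; rewrite eqn_leq N1'.
Qed.

(** * Colourings of simple graphs *)

Lemma eq_set2 (T : finType) (a b c d : T) :
  ([set a; b] == [set c; d]) = ((a == c) && (b == d)) || ((a == d) && (b == c)).
Proof.
apply/eqP/orP => [e|[/andP[/eqP-> /eqP->]|/andP[/eqP-> /eqP->]] //]; last by rewrite setUC.
have : a \in [set c; d] by rewrite -e !inE eqxx.
have : b \in [set c; d] by rewrite -e !inE eqxx orbT.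
have : c \in [set a; b] by rewrite e !inE eqxx.
have : d \in [set a; b] by rewrite e !inE eqxx orbT.
rewrite !inE (eq_sym d a) (eq_sym d b) (eq_sym c a) (eq_sym c b).
move=> d' c' b' a'; apply/orP; move: a' b' c' d'.
by case: (a == c); case: (a == d); case: (b == c); case: (b == d).
Qed.

Lemma mem_star (T : finType) (c x y : T) (N : {set T}) :
  ([set x; y] \in [set [set c; w] | w in N]) = ((x == c) && (y \in N)) || ((y == c) && (x \in N)).
Proof.
apply/imsetP/orP => [[w wN /eqP]|].
  by rewrite eq_set2 => /orP[] /andP[/eqP-> /eqP->]; rewrite eqxx wN; [left|right].
case=> /andP[/eqP-> wN]; first by exists y.
by exists x => //; rewrite setUC.
Qed.

Section Adjacency.
Variables (T : finType) (G : sgraph T).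

Lemma adj_sym : symmetric (adj G).
Proof. by move=> x y; rewrite /adj setUC. Qed.

Lemma adj_vset x y : adj G x y -> [/\ x \in vset G, y \in vset G & x != y].
Proof.
move/esetP/andP=> [/subsetP s]; rewrite cards2.
by case: (x != y) => // _; split=> //; apply: s; rewrite !inE eqxx ?orbT.
Qed.

Lemma adj_irr : irreflexive (adj G).
Proof. by move=> x; apply/negP => /adj_vset[_ _]; rewrite eqxx. Qed.

Lemma edge_ends (e : {set T}) : e \in eset G -> exists x y, e = [set x; y] /\ adj G x y.
Proof.
move=> eG; have /andP[_ /cards2P[x [y [xy eE]]]] := esetP eG.
by exists x, y; rewrite /adj -eE.
Qed.

End Adjacency.

Lemma family_of_relation (T I : finType) (E : rel T) (P : I -> rel T) :
  (forall i, symmetric (P i)) ->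
  (forall i x y z, P i x y -> P i x z -> y = z) ->
  (forall i j x y, P i x y -> P j x y -> i = j) ->
  (forall i x y, P i x y -> E x y) -> (forall x y, E x y -> exists i, P i x y) ->
  exists m : I -> T -> T, [/\ complete E m, forall i x y, P i x y -> m i x = y
    & forall i x, m i x != x -> P i x (m i x)].
Proof.
move=> Psym Pfun Pinj PE EP.
(* The default [x] encodes a colour missing at [x]. *)
pose m i x := odflt x [pick y | P i x y].
have mP i x y : P i x y -> m i x = y.
  by move=> xy; rewrite /m; case: pickP => [z xz|/(_ y)]; [apply: Pfun xz xy|rewrite xy].
have Pm i x : m i x != x -> P i x (m i x).
  by rewrite /m; case: pickP => [z xz|] //=; rewrite eqxx.
exists m; split=> //; split=> [|i x /Pm/PE //|x y /EP[i /mP]]; last by exists i.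
split=> [i x|i j x e /eqP h].
  have [e|/Pm xm] := eqVneq (m i x) x; first by rewrite !e.
  by apply: mP; rewrite Psym.
by apply: Pinj (Pm _ _ h) _; rewrite e; apply: Pm; rewrite -e.
Qed.

Lemma family_of_colouring (T : finType) (G : sgraph T) k : edge_colorable G k ->
  exists m : 'I_k -> T -> T, complete (adj G) m.
Proof.
case/existsP=> c /forallP cP.
pose P i x y := [exists e : edge G, (val e == [set x; y]) && (c e == i)].
have PE i x y : P i x y -> adj G x y.
  by case/existsP=> e /andP[/eqP eE _]; rewrite /adj -eE (valP e).
have [|||||m [mC _ _]] := @family_of_relation T 'I_k (adj G) P; last by exists m.
- by move=> i x y; apply: eq_existsb => e; rewrite setUC.
- move=> i x y z xy xz; case/existsP: (xy) => e /andP[/eqP eE /eqP ci].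
  case/existsP: (xz) => f /andP[/eqP fE /eqP cf].
  have [ef|ef] := eqVneq e f.
    have /eqP : [set x; y] = [set x; z] by rewrite -eE -fE ef.
    rewrite eq_set2 eqxx /= => /orP[/eqP //|/andP[/eqP xz' _]].
    by have := PE _ _ _ xz; rewrite xz' adj_irr.
  have /forallP/(_ f)/implyP := cP e; rewrite ef ci cf eqxx => h.
  have /h // : true && (val e :&: val f != set0).
  by apply/set0Pn; exists x; rewrite eE fE !inE eqxx.
- move=> i j x y /existsP[e /andP[/eqP eE /eqP <-]] /existsP[f /andP[/eqP fE /eqP <-]].
  by congr (c _); apply: val_inj; rewrite eE fE.
- exact: PE.
move=> x y xy; exists (c (exist _ [set x; y] xy)); apply/existsP.
by exists (exist _ [set x; y] xy); rewrite /= !eqxx.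
Qed.

(** [E] may exceed the adjacency of [G], so that a colouring of a graph minus an edge serves all its
    subgraphs without that edge. *)
Lemma colouring_of_family (T I : finType) (G : sgraph T) (E : rel T) (m : I -> T -> T) (i0 : I) :
  (forall x y, adj G x y -> E x y) -> complete E m -> edge_colorable G #|I|.
Proof.
move=> GE mC; have [_ _ Em] := mC.
pose P (e : edge G) i := [exists x, val e == [set x; m i x]].
pose c e := odflt i0 [pick i | P e i].
have Pz e i z : P e i -> z \in val e -> val e = [set z; m i z].
  case/existsP=> x /eqP->; rewrite !inE => /orP[/eqP->//|/eqP->].
  by rewrite (completeK _ mC) setUC.
have Pc e : P e (c e).
  rewrite /c; case: pickP => //= none.
  have [x [y [eE /GE/Em[i mi]]]] := edge_ends (valP e).
  have : P e i by apply/existsP; exists x; rewrite mi eE.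
  by rewrite none.
apply/existsP; exists [ffun e => enum_rank (c e)].
apply/forallP => e; apply/forallP => f; apply/implyP => /andP[ef /set0Pn[z]].
rewrite inE => /andP[ze zf]; rewrite !ffunE (inj_eq enum_rank_inj).
apply: contra ef => /eqP ce; apply/eqP/val_inj.
by rewrite (Pz _ _ _ (Pc e) ze) (Pz _ _ _ (Pc f) zf) ce.
Qed.

Lemma chromatic_index_le (T : finType) (G : sgraph T) k : edge_colorable G k -> chromatic_index G <= k.
Proof. by rewrite /chromatic_index; case: ex_minnP => n _; apply. Qed.

Lemma chromatic_index_colorable (T : finType) (G : sgraph T) : edge_colorable G (chromatic_index G).
Proof. by rewrite /chromatic_index; case: ex_minnP. Qed.

(* The colour freed by deleting [s u] can be given to [s t]. *)
Lemma shift_edge (T I : finType) (E : rel T) (m : I -> T -> T) s t u :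
  symmetric E -> irreflexive E -> E s t -> E s u -> u != t -> complete (delete E s t) m ->
  (forall i, m i s != s -> m i t = t) -> exists m' : I -> T -> T, complete (delete E s u) m'.
Proof.
move=> Esym Eirr st su ut mC dis; have [_ _ Em] := mC.
have us : u != s by apply: contraTneq su => ->; rewrite Eirr.
have ts : t != s by apply: contraTneq st => ->; rewrite Eirr.
have [i mi] : exists i, m i s = u.
  by apply: Em; rewrite /delete /= su (negPf ut) (negPf us) !andbF.
have su' : s != u by rewrite eq_sym.
have m'C := eq_complete (deleteC E s t s u) (uncolour_complete mC mi su').
exists (colour (uncolour m i s u) i s t); apply: colour_complete m'C _ _.
- exact: delete_sym.
- exact: delete_irr.
- by rewrite /delete /= st eqxx (negPf ts) andbF orbF /= eq_sym.
- by rewrite /uncolour !eqxx.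
have mt : m i t = t by apply: dis; rewrite mi.
by rewrite /uncolour mt if_same.
Qed.

(** * Vertex splitting *)

Section Splitting.
Variables (T : finType) (Gs G : sgraph T) (D : nat) (v v1 v2 : T) (N1 N2 : {set T}).
Hypotheses (reg : regular D Gs) (vGs : v \in vset Gs).
Hypotheses (v1Gs : v1 \notin vset Gs) (v2Gs : v2 \notin vset Gs) (v12 : v1 != v2).
Hypotheses (N12 : N1 :|: N2 = nbrs Gs v) (disj : [disjoint N1 & N2]) (N1n : N1 != set0) (N2n : N2 != set0).
Hypotheses (vG : vset G = [set v1; v2] :|: (vset Gs :\ v))
  (eG : eset G = [set e in eset Gs | v \notin e] :|: [set [set v1; v2]]
                 :|: [set [set v1; x] | x in N1] :|: [set [set v2; x] | x in N2]).

(** The contraction of [v1 v2] back to [v]. It matches the edges of [G - v1 v2] with those of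
    [Gs]. *)
Let split_pi z := if (z == v1) || (z == v2) then v else z.

Lemma adj_split x y : adj G x y = [|| [&& adj Gs x y, x != v & y != v],
  ((x == v1) && (y == v2)) || ((x == v2) && (y == v1)),
  ((x == v1) && (y \in N1)) || ((y == v1) && (x \in N1))
  | ((x == v2) && (y \in N2)) || ((y == v2) && (x \in N2))].
Proof.
rewrite /adj eG !in_setU !mem_star in_set1 eq_set2 inE -!orbA; congr (_ && _ || _).
by rewrite !inE negb_or ![v == _]eq_sym.
Qed.

Lemma N1_nbr x : x \in N1 -> adj Gs v x.
Proof. by move=> xN; have : x \in nbrs Gs v; [rewrite -N12 inE xN | rewrite inE]. Qed.

Lemma N2_nbr x : x \in N2 -> adj Gs v x.
Proof. by move=> xN; have : x \in nbrs Gs v; [rewrite -N12 inE xN orbT | rewrite inE]. Qed.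

Lemma N12_disj x : x \in N1 -> x \in N2 -> False.
Proof. by move=> h1 h2; have := disjointFr disj h1; rewrite h2. Qed.

Lemma old_neq x : x \in vset Gs -> (x == v1 = false) * (x == v2 = false).
Proof. by move=> xG; split; apply: contraTF xG => /eqP->. Qed.

Lemma N_old x : x \in N1 \/ x \in N2 -> x \in vset Gs.
Proof. by case=> [/N1_nbr|/N2_nbr] /adj_vset[]. Qed.

Lemma N1_v x : x \in N1 -> x == v = false.
Proof. by move/N1_nbr/adj_vset=> [_ _]; rewrite eq_sym => /negPf. Qed.

Lemma vset_split x : x \in vset G = [|| x == v1, x == v2 | (x != v) && (x \in vset Gs)].
Proof. by rewrite vG !inE -orbA. Qed.

Lemma neighbours_v1 : neighbours (adj G) v1 = v2 |: N1.
Proof.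
apply/setP => x; rewrite !inE adj_split eqxx (negPf v12) /= orbF.
have -> : adj Gs v1 x = false by apply/negP => /adj_vset[h]; rewrite (negPf v1Gs) in h.
have -> : v1 \in N1 = false by apply/negP => h; have := N_old (or_introl h); rewrite (negPf v1Gs).
have -> : v1 \in N2 = false by apply/negP => h; have := N_old (or_intror h); rewrite (negPf v1Gs).
by rewrite !andbF !orbF.
Qed.

Lemma neighbours_v2 : neighbours (adj G) v2 = v1 |: N2.
Proof.
apply/setP => x; rewrite !inE adj_split eqxx [v2 == v1]eq_sym (negPf v12) /=.
have -> : adj Gs v2 x = false by apply/negP => /adj_vset[h]; rewrite (negPf v2Gs) in h.
have -> : v2 \in N1 = false by apply/negP => h; have := N_old (or_introl h); rewrite (negPf v2Gs).
have -> : v2 \in N2 = false by apply/negP => h; have := N_old (or_intror h); rewrite (negPf v2Gs).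
by rewrite !andbF !orbF.
Qed.

Lemma cardN12 : #|N1| + #|N2| = D.
Proof. by rewrite -(reg vGs) /deg -N12 -cardsUI (disjoint_setI0 disj) cards0 addn0. Qed.

Lemma degree_v1 : #|neighbours (adj G) v1| = #|N1|.+1.
Proof.
rewrite neighbours_v1 cardsU1 (_ : v2 \in N1 = false) //.
by apply/negP => h; have := N_old (or_introl h); rewrite (negPf v2Gs).
Qed.

Lemma degree_v2 : #|neighbours (adj G) v2| = #|N2|.+1.
Proof.
rewrite neighbours_v2 cardsU1 (_ : v1 \in N2 = false) //.
by apply/negP => h; have := N_old (or_intror h); rewrite (negPf v1Gs).
Qed.

Let E0 := delete (adj G) v1 v2.

Lemma E0_pi x y : E0 x y -> adj Gs (split_pi x) (split_pi y).
Proof.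
rewrite /E0 /delete /= adj_split => /andP[h n]; case/or4P: h => [/and3P[xy _ _]|h|h|h].
- have [xG yG _] := adj_vset xy.
  by rewrite /split_pi !(old_neq xG) !(old_neq yG).
- by rewrite h in n.
- case/orP: h => /andP[/eqP-> /[dup] wN /N1_nbr vw]; have wG := N_old (or_introl wN);
    rewrite /split_pi eqxx /= !(old_neq wG) //.
  by rewrite adj_sym.
case/orP: h => /andP[/eqP-> /[dup] wN /N2_nbr vw]; have wG := N_old (or_intror wN);
  rewrite /split_pi eqxx orbT /= !(old_neq wG) //.
by rewrite adj_sym.
Qed.

Lemma adj_old x y : x \in vset Gs -> adj G x y -> y \in [:: v1; v2] ->
  [/\ y = v1 & x \in N1] \/ [/\ y = v2 & x \in N2].
Proof.
move=> xG; rewrite adj_split !inE !(old_neq xG) /= => h /orP[]/eqP yE; move: h; rewrite yE eqxx.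
  rewrite (negPf v12) /= orbF => /orP[/and3P[/adj_vset[_ h]]|]; last by left.
  by rewrite (negPf v1Gs) in h.
rewrite [v2 == v1]eq_sym (negPf v12) /= => /orP[/and3P[/adj_vset[_ h]]|]; last by right.
by rewrite (negPf v2Gs) in h.
Qed.

Lemma pi_inj x y z : x != v1 -> x != v2 -> adj G x y -> adj G x z -> split_pi y = split_pi z -> y = z.
Proof.
move=> x1 x2 xy xz; have [xV _ _] := adj_vset xy.
have xG : x \in vset Gs by move: xV; rewrite vset_split (negPf x1) (negPf x2) => /andP[].
have nv t : adj G x t -> t == v = false.
  move=> /adj_vset[_ + _]; rewrite vset_split => /or3P[/eqP->|/eqP->|/andP[/negPf]] //.
    by apply: contraNF v1Gs => /eqP->.
  by apply: contraNF v2Gs => /eqP->.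
have key t : (t == v1) || (t == v2) = (t \in [:: v1; v2]) by rewrite !inE.
rewrite /split_pi !key; case: ifP => yV; case: ifP => zV //.
- case: (adj_old xG xy yV) => -[-> h]; case: (adj_old xG xz zV) => -[-> h'] //.
    by case: (N12_disj h h').
  by case: (N12_disj h' h).
- by move=> e; have := nv _ xz; rewrite -e eqxx.
by move=> e; have := nv _ xy; rewrite e eqxx.
Qed.

Lemma degree_old x : x \in vset Gs -> x != v -> #|neighbours (adj G) x| = D.
Proof.
move=> xG xv; rewrite -(reg xG) /deg.
have [x1 x2] := old_neq xG.
have <- : split_pi @: neighbours (adj G) x = nbrs Gs x; last first.
  by rewrite card_in_imset // => y z; rewrite !inE; apply: pi_inj; rewrite ?x1 ?x2.
apply/setP => t; rewrite inE; apply/imsetP/idP => [[y]|xt].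
  rewrite inE => xy ->; have := E0_pi (x := x) (y := y); rewrite {1}/split_pi x1 x2 /=.
  by apply; rewrite /E0 /delete /= xy x1 x2.
have [_ tG _] := adj_vset xt; have [t1 t2] := old_neq tG.
have [tv|tv] := eqVneq t v; last first.
  by exists t; rewrite ?inE ?adj_split ?xt ?xv ?tv // /split_pi t1 t2.
have : x \in N1 :|: N2 by rewrite N12 inE adj_sym -tv.
rewrite inE => /orP[xN|xN].
  by exists v1; rewrite ?inE ?adj_split ?eqxx ?xN ?orbT // /split_pi eqxx tv.
by exists v2; rewrite ?inE ?adj_split ?eqxx ?xN ?orbT // /split_pi eqxx orbT tv.
Qed.

Lemma degree_ord z : z \in vset G -> z != v1 -> z != v2 -> #|neighbours (adj G) z| = D.
Proof.
rewrite vset_split => /or3P[/eqP->|/eqP->|/andP[zv zG] _ _]; rewrite ?eqxx //.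
exact: degree_old.
Qed.

Lemma E0_inj x y z : E0 x y -> E0 x z -> split_pi y = split_pi z -> y = z.
Proof.
move=> xy xz; have [/andP[axy ny] /andP[axz nz]] := (xy, xz).
have [x1|x1] := eqVneq x v1; last have [x2|x2] := eqVneq x v2; last exact: (pi_inj x1 x2 axy axz).
  have inN t : E0 x t -> t \in N1.
    rewrite x1 => /andP[h n]; have : t \in neighbours (adj G) v1 by rewrite inE.
    rewrite neighbours_v1 !inE => /orP[/eqP e|//].
    by move: n; rewrite e !eqxx.
  have [yG zG] := (N_old (or_introl (inN _ xy)), N_old (or_introl (inN _ xz))).
  by rewrite /split_pi !(old_neq yG) !(old_neq zG).
have inN t : E0 x t -> t \in N2.
  rewrite x2 => /andP[h n]; have : t \in neighbours (adj G) v2 by rewrite inE.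
  rewrite neighbours_v2 !inE => /orP[/eqP e|//].
  by move: n; rewrite e !eqxx orbT.
have [yG zG] := (N_old (or_intror (inN _ xy)), N_old (or_intror (inN _ xz))).
by rewrite /split_pi !(old_neq yG) !(old_neq zG).
Qed.

(** Colours are pulled back along [split_pi]. A colour occurs only once at [v], hence not at both
    [v1] and [v2]; [shift_edge] relies on this. *)
Lemma split_family (m : 'I_D -> T -> T) : complete (adj Gs) m ->
  exists m0 : 'I_D -> T -> T, complete E0 m0 /\ forall i, m0 i v1 != v1 -> m0 i v2 = v2.
Proof.
move=> mC; have [_ mE Em] := mC.
have E0sym : symmetric E0 by apply: delete_sym; apply: adj_sym.
pose P i x y := E0 x y && (m i (split_pi x) == split_pi y).
have [|||||m0 [m0C _ m0P]] := @family_of_relation T 'I_D E0 P.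
- by move=> i x y; rewrite /P E0sym (can2_eq (completeK i mC) (completeK i mC)) eq_sym.
- by move=> i x y z /andP[xy /eqP e] /andP[xz /eqP e']; apply: E0_inj xy xz _; rewrite -e.
- move=> i j x y /andP[/E0_pi/adj_vset[_ _ n] /eqP e] /andP[_ /eqP e'].
  by apply: (complete_proper (x := split_pi x) mC); rewrite ?e ?e' // eq_sym.
- by move=> i x y /andP[].
- by move=> x y xy; have [i mi] := Em _ _ (E0_pi xy); exists i; rewrite /P xy mi eqxx.
exists m0; split=> // i n1; apply/eqP/contraT => n2.
have [/andP[h1 /eqP e1] /andP[h2 /eqP e2]] := (m0P _ _ n1, m0P _ _ n2).
have w1 : m0 i v1 \in N1.
  have : m0 i v1 \in neighbours (adj G) v1 by rewrite inE; case/andP: h1.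
  rewrite neighbours_v1 !inE => /orP[/eqP e|//].
  by move: h1; rewrite e /E0 /delete /= !eqxx andbF.
have w2 : m0 i v2 \in N2.
  have : m0 i v2 \in neighbours (adj G) v2 by rewrite inE; case/andP: h2.
  rewrite neighbours_v2 !inE => /orP[/eqP e|//].
  by move: h2; rewrite e /E0 /delete /= !eqxx orbT andbF.
have [g1 g2] := (N_old (or_introl w1), N_old (or_intror w2)).
move: e1 e2; rewrite /split_pi !eqxx orbT /= !(old_neq g1) !(old_neq g2) /= => e1 e2.
by case: (N12_disj w1); rewrite -e1 e2.
Qed.


Lemma adj_v12 : adj G v1 v2.
Proof. by have : v2 \in neighbours (adj G) v1; [rewrite neighbours_v1 !inE eqxx | rewrite inE]. Qed.

Lemma N1_gt0 : 0 < #|N1|. Proof. by rewrite card_gt0. Qed.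
Lemma N2_gt0 : 0 < #|N2|. Proof. by rewrite card_gt0. Qed.

Lemma card_vset_split : #|vset G| = #|vset Gs|.+1.
Proof.
rewrite vG cardsU (_ : _ :&: _ = set0) ?cards0 ?subn0; last first.
  apply/setP => x; rewrite !inE; apply/negP => /andP[/orP[]/eqP-> /andP[_]]; exact/negP.
by rewrite cards2 v12 [in RHS](cardsD1 v) vGs.
Qed.

Lemma vertex_degree_pos x : x \in vset G -> 0 < #|neighbours (adj G) x|.
Proof.
rewrite vset_split => /or3P[/eqP->|/eqP->|/andP[xv xG]].
- by rewrite degree_v1.
- by rewrite degree_v2.
by rewrite degree_old // -cardN12 addn_gt0 N1_gt0.
Qed.

Lemma max_deg_split : max_deg G = D.
Proof.
have degE x : deg G x = #|neighbours (adj G) x| by [].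
have le1 : #|N1|.+1 <= D by rewrite -cardN12 -addn1 leq_add2l N2_gt0.
have le2 : #|N2|.+1 <= D by rewrite -cardN12 -add1n leq_add2r N1_gt0.
apply/eqP; rewrite eqn_leq; apply/andP; split.
  apply/bigmax_leqP => x; rewrite vset_split degE => /or3P[/eqP->|/eqP->|/andP[xv xG]].
  - by rewrite degree_v1.
  - by rewrite degree_v2.
  by rewrite degree_old.
have /set0Pn[x xN] := N1n; have xG := N_old (or_introl xN); have /negbT xv := N1_v xN.
rewrite -[X in X <= _](degree_old xG xv); apply: (@leq_bigmax_cond _ [in vset G] (deg G)).
by rewrite vset_split xv xG !orbT.
Qed.

(** In a [D]-regular graph with [D] colours every colour class is a perfect matching. *)
Lemma even_order (m : 'I_D -> T -> T) : complete (adj Gs) m -> ~~ odd #|vset Gs|.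
Proof.
move=> mC; have D0 : 0 < D by rewrite -cardN12 addn_gt0 N1_gt0.
pose i := Ordinal D0; have [_ mE _] := mC.
have mi x : x \in vset Gs -> m i x != x.
  move=> xG; apply: (complete_all (@adj_irr _ Gs) mC).
  by rewrite card_ord -(reg xG).
rewrite -(odd_fixed_involution (completeK i mC)) => [|x xG].
  rewrite (_ : finset _ = set0) ?cards0 //; apply/setP => x; rewrite !inE.
  by case xG: (x \in vset Gs) => //=; apply/negbTE/mi.
by have /adj_vset[] := mE i x (mi x xG).
Qed.

(* Every colour class misses a vertex of [G], which can only be [v1] or [v2]. *)
Lemma overfull (m : 'I_D -> T -> T) k : complete (adj Gs) m -> edge_colorable G k -> D < k.
Proof.
move=> /even_order ev /family_of_colouring[m' mC]; rewrite ltnNge; apply/negP => kD.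
have irr := @adj_irr _ G; have [_ mE _] := mC.
have used z : #|neighbours (adj G) z| <= k.
  by rewrite -(complete_degree z irr mC) (leq_trans (max_card _)) ?card_ord.
have fixed i : m' i v1 = v1 \/ m' i v2 = v2.
  have fG : {in vset G, forall x, m' i x \in vset G}.
    move=> x xG; have [->//|mx] := eqVneq (m' i x) x.
    by have /adj_vset[] := mE _ _ mx.
  have := odd_fixed_involution (completeK i mC) fG; rewrite card_vset_split /= ev.
  case: (set_0Vmem [set x in vset G | m' i x == x]) => [->|[z]]; first by rewrite cards0.
  rewrite inE => /andP[zG /eqP mz] _.
  have [z1|z1] := eqVneq z v1; first by left; rewrite -z1.
  have [z2|z2] := eqVneq z v2; first by right; rewrite -z2.
  have dz := degree_ord zG z1 z2; have := used z; rewrite dz => Dk.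
  have := complete_all (x := z) irr mC; rewrite dz card_ord => /(_ _ i).
  by rewrite mz eqxx => h; case/negP: (h (anti_leq (introT andP (conj Dk kD)))).
(* No colour occurs at both [v1] and [v2], yet their degrees in [G] add up to [D + 2]. *)
have : #|[set i | m' i v1 != v1]| + #|[set i | m' i v2 != v2]| <= k.
  rewrite -cardsUI (_ : _ :&: _ = set0) ?cards0 ?addn0.
    by rewrite (leq_trans (max_card _)) ?card_ord.
  apply/setP => i; rewrite !inE; case: (fixed i) => ->; by rewrite eqxx ?andbF.
rewrite !(complete_degree _ irr mC) degree_v1 degree_v2 addSn addnS cardN12 => h.
by have := leq_trans h kD; rewrite ltnNge leqnSn.
Qed.

Lemma colourable_succ (m : 'I_D -> T -> T) : complete (adj Gs) m -> edge_colorable G D.+1.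
Proof.
case/split_family=> m0 [m0C _]; have [[mK mI] mE Em] := m0C.
pose m1 (o : option 'I_D) := if o is Some i then m0 i else id.
have m1C : complete E0 m1.
  split=> [|[i|] x|x y]; rewrite /m1 ?eqxx //; last 1 first.
  - by case/Em=> i mi; exists (Some i).
  - split=> [[i|] x|[i|] [j|] x] //=; first exact: mK.
    by move=> /mI h /h ->.
  exact: mE.
have := colour_complete (c := None) (@adj_sym _ G) (@adj_irr _ G) adj_v12 m1C erefl erefl.
by move/(colouring_of_family None (fun x y => id)); rewrite card_option card_ord.
Qed.

Lemma critical_edge (m : 'I_D -> T -> T) x y : complete (adj Gs) m -> 2 * (#|vset Gs| - 1) <= 3 * D ->
  adj G x y -> ~ (exists m' : 'I_D -> T -> T, complete (delete (adj G) x y) m') -> False.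
Proof.
move=> mC dense xy none; have [m0 [m0C m0d]] := split_family mC.
have Gsym := @adj_sym _ G; have Girr := @adj_irr _ G.
have m0C' := eq_complete (delete_swap (adj G) v1 v2) m0C.
have m0d' i : m0 i v2 != v2 -> m0 i v1 = v1.
  by move=> h; apply/eqP; apply: contraT => /m0d e; rewrite e eqxx in h.
have at1 u : adj G v1 u -> exists m' : 'I_D -> T -> T, complete (delete (adj G) v1 u) m'.
  move=> h; have [->|uv] := eqVneq u v2; first by exists m0.
  exact: (shift_edge Gsym Girr adj_v12 h uv m0C m0d).
have adj_v21 : adj G v2 v1 by rewrite Gsym adj_v12.
have at2 u : adj G v2 u -> exists m' : 'I_D -> T -> T, complete (delete (adj G) v2 u) m'.
  move=> h; have [->|uv] := eqVneq u v1; first by exists m0.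
  exact: (shift_edge Gsym Girr adj_v21 h uv m0C' m0d').
have flip u : (exists m' : 'I_D -> T -> T, complete (delete (adj G) u x) m') ->
    (exists m' : 'I_D -> T -> T, complete (delete (adj G) x u) m').
  by case=> m' m'C; exists m'; apply: eq_complete m'C; apply: delete_swap.
have yx : adj G y x by rewrite Gsym.
have [xe|x1] := eqVneq x v1; first by apply: none; rewrite xe in xy *; apply: at1.
have [xe|x2] := eqVneq x v2; first by apply: none; rewrite xe in xy *; apply: at2.
have [ye|y1] := eqVneq y v1; first by apply: none; rewrite ye in yx *; apply/flip/at1.
have [ye|y2] := eqVneq y v2; first by apply: none; rewrite ye in yx *; apply/flip/at2.
have [xG yG xny] := adj_vset xy.
have E0sym : symmetric E0 by apply: delete_sym.
have E0irr : irreflexive E0 by apply: delete_irr.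
have E0xy : E0 x y by rewrite /E0 /delete /= xy (negPf x1) (negPf x2).
have E0yx : E0 y x by rewrite E0sym.
have v1G : v1 \in vset G by rewrite vset_split eqxx.
have v2G : v2 \in vset G by rewrite vset_split eqxx orbT.
have nv1 : neighbours (delete E0 x y) v1 = N1.
  rewrite neighbours_delete_id 1?eq_sym // neighbours_delete ?adj_v12 // neighbours_v1.
  rewrite setU1K //; apply/negP => h; have := N_old (or_introl h); exact/negP.
have nv2 : neighbours (delete E0 x y) v2 = N2.
  rewrite neighbours_delete_id 1?eq_sym //.
  have -> : neighbours E0 v2 = neighbours (delete (adj G) v2 v1) v2.
    by apply/setP => z; rewrite !inE /E0 delete_swap.
  rewrite neighbours_delete // neighbours_v2 setU1K //.
  apply/negP => h; have := N_old (or_intror h); exact/negP.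
have degE z : z != v1 -> z != v2 -> z \in vset G -> #|neighbours E0 z| = D.
  by move=> z1 z2 zG; rewrite neighbours_delete_id // degree_ord.
have res : @residual T 'I_D (delete E0 x y) (vset G) v1 v2 x y.
  split.
  - exact: delete_sym.
  - exact: delete_irr.
  - by rewrite /= !inE !negb_or v12 ![_ == x]eq_sym ![_ == y]eq_sym x1 x2 y1 y2 (eq_sym y) xny.
  - by move=> z; rewrite !inE => /or4P[]/eqP->.
  - move=> z zG; rewrite !inE !negb_or => /and4P[z1 z2 zx zy].
    by rewrite neighbours_delete_id // card_ord degE.
  - by move=> z w /andP[/andP[/adj_vset[]]].
  - by rewrite degree_delete // card_ord degE.
  - rewrite (_ : neighbours _ y = neighbours (delete E0 y x) y).
      by rewrite degree_delete // card_ord degE.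
    by apply/setP => z; rewrite !inE delete_swap.
  - by rewrite nv1 nv2 card_ord cardN12.
  - by rewrite nv1 N1_gt0.
  - by rewrite nv2 N2_gt0.
  - move=> z z1 z2; apply: (@N12_disj z); first by rewrite -nv1 inE.
    by rewrite -nv2 inE.
  - by rewrite /E0 /delete /= !eqxx andbF.
  - by rewrite /delete /= !eqxx andbF.
  (* The colour released by [x y] becomes missing at both [x] and [y]. *)
  - have [_ _ Em] := m0C; have [i mi] := Em _ _ E0xy.
    exists (uncolour m0 i x y), i; split; first exact: uncolour_complete.
      by rewrite /uncolour !eqxx.
    by rewrite /uncolour !eqxx orbT.
  (* A colour free at both [v1] and [v2] would extend the colouring to [G - x y]. *)
  move=> m' c m'C h1 h2; apply: none.
  have m'C' := eq_complete (deleteC (adj G) v1 v2 x y) m'C.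
  exists (colour m' c v1 v2); apply: (colour_complete _ _ _ m'C' h1 h2).
  - exact: delete_sym.
  - exact: delete_irr.
  by rewrite /delete /= adj_v12 ![v1 == _]eq_sym (negPf x1) (negPf y1).
by apply: (residual_dense card_vset_split _ res); rewrite card_ord.
Qed.

Lemma critical_split (m : 'I_D -> T -> T) : complete (adj Gs) m ->
  2 * (#|vset Gs| - 1) <= 3 * D -> critical D G.
Proof.
move=> mC dense; have D0 : 0 < D by rewrite -cardN12 addn_gt0 N1_gt0.
have chi : chromatic_index G = D.+1.
  apply/eqP; rewrite eqn_leq chromatic_index_le ?(colourable_succ mC) //.
  exact: (overfull mC (chromatic_index_colorable G)).
split=> // [|H /andP[/andP[/subsetP sV /subsetP sE] proper]]; first exact: max_deg_split.
rewrite chi ltnS; apply/contraT => hD.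
(* [G] has no isolated vertices, so a subgraph with all its edges has all its vertices too. *)
have [e eGe eH] : exists2 e, e \in eset G & e \notin eset H.
  apply/subsetPn; apply: contraL proper => EG; rewrite negb_or !negbK.
  have eE : eset H = eset G by apply/eqP; rewrite eqEsubset EG andbT; apply/subsetP.
  rewrite eE eqxx andbT eqEsubset; apply/andP; split; apply/subsetP => // x.
  move/vertex_degree_pos/card_gt0P=> [y]; rewrite inE /adj -eE.
  by case/(@adj_vset _ H).
have [x [y [eE xy]]] := edge_ends eGe.
have [] := critical_edge mC dense xy; case=> m' m'C; case/negP: hD.
apply: chromatic_index_le; rewrite -[D]card_ord.
apply: (colouring_of_family (Ordinal D0) _ m'C) => s t st.
rewrite /delete /= /adj sE //=; apply: contra eH; rewrite eE => /orP[] /andP[/eqP<- /eqP<-] //.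
by rewrite setUC.
Qed.

End Splitting.

Theorem theorem1p2 (T : finType) (Gstar G : sgraph T) (n D : nat) :
  #|vset Gstar| = n ->
  connected Gstar ->
  class1 Gstar ->
  regular D Gstar ->
  2 * (n - 1) <= 3 * D ->
  vertex_splitting Gstar G ->
  critical D G.
Proof.
move=> cn _ c1 reg dense [v vG [v1 [v2 [N1 [N2 [[h1 h2 h3] [h4 h5 h6 h7] h8 h9]]]]]].
have maxD : max_deg Gstar = D.
  apply/eqP; rewrite eqn_leq; apply/andP; split; first by apply/bigmax_leqP => x /reg ->.
  by rewrite -(reg _ vG); apply: (@leq_bigmax_cond _ [in vset Gstar] (deg Gstar)).
have [m mC] : exists m : 'I_D -> T -> T, complete (adj Gstar) m.
  by apply: family_of_colouring; rewrite -maxD -c1; apply: chromatic_index_colorable.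
by apply: (critical_split reg vG h1 h2 h3 h4 h5 h6 h7 h8 h9 mC); rewrite cn.
Qed.
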